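(* Let $\gamma:[0,1]\rightarrow\mathbb{R}^d$ be a continuous path with bounded variation. Suppose that $\log S(\gamma)_{s,t}$ has infinite radius of convergence for all $[s,t]\subseteq[0,1]$. Then $\gamma_t=\gamma_0+f(t)\cdot\vec{v}$ for some real-valued function $f:[0,1]\to\mathbb{R}$ and some fixed vector $\vec{v}\in\mathbb{R}^d$.
   Context: For a continuous path $\gamma$ of bounded variation in $V=\mathbb{R}^d$ and $s\leqslant t$, its signature over $[s,t]$ is the formal tensor series $$S(\gamma)_{s,t}=\Big(1,\gamma_t-\gamma_s,\cdots,\int_{s<t_1<\cdots<t_n<t}d\gamma_{t_1}\otimes\cdots\otimes d\gamma_{t_n},\cdots\Big)\in T((V))=\prod_{n\geqslant0}V^{\otimes n}$$ (Lebesgue-Stieltjes integrals). $T((V))$ has product $(\xi\otimes\eta)_n=\sum_{k=0}^n\xi_k\otimes\eta_{n-k}$, and for $\xi_0=1$, $\log\xi=\sum_{n\geqslant1}\frac{(-1)^{n-1}}{n}(\xi-\mathbf{1})^{\otimes n}$. Each $V^{\otimes n}$ carries the projective tensor norm $\|\xi\|=\inf\{\sum_j|v_1^j|\cdots|v_n^j|:\ \xi=\sum_j v_1^j\otimes\cdots\otimes v_n^j\}$. The radius of convergence of $\xi=(\xi_0,\xi_1,\dots)\in T((V))$ is the radius of convergence of the power series $\sum_{n\geqslant0}\|\xi_n\|z^n$. *)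

(* Defs.v *)
From HB Require Import structures.
From mathcomp Require Import all_boot all_order all_algebra.
From mathcomp Require Import mathcomp_extra boolp classical_sets functions.
From mathcomp Require Import set_interval reals ereal interval_inference.
From mathcomp Require Import topology normedtype sequences real_interval.
From mathcomp Require Import realfun exp numfun measure lebesgue_measure.
From mathcomp Require Import lebesgue_stieltjes_measure lebesgue_integral.
Set Implicit Arguments.
Unset Strict Implicit.
Unset Printing Implicit Defensive.
Import Order.TTheory GRing.Theory Num.Theory.
Import numFieldNormedType.Exports.
Local Open Scope classical_set_scope.
Local Open Scope ring_scope.

Section LebesgueStieltjesIntegral.
Context {R : realType}.
Implicit Types (g h : R -> R) (x y : R).

Definition clamp01 x : R := Num.max 0 (Num.min x 1).

Lemma clamp01_itv x : clamp01 x \in `[0, 1].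
Proof. by rewrite in_itv/= le_max lexx ge_max ler01 ge_min lexx orbT. Qed.

Lemma clamp01_le x y : x <= y -> clamp01 x <= clamp01 y.
Proof.
move=> xy; rewrite ge_max !le_max lexx/=; apply/orP; right.
by rewrite le_min !ge_min xy lexx orbT.
Qed.

Lemma clamp01_id x : x \in `[0, 1] -> clamp01 x = x.
Proof.
by rewrite in_itv/= => /andP[x0 x1]; rewrite /clamp01 (min_idPl x1) (max_idPr x0).
Qed.

(* The decreasing part of the Jordan decomposition g = g+ - g- on [0, 1],
   extended by constants to the whole line; as in the library, the increasing
   part is that of - g. *)
Definition var_part g : R -> R := fine \o neg_tv 0 g \o clamp01.

Section cumulative_var_part.
Variable g : R -> R.
Hypothesis cg : {within `[0, 1], continuous g}.
Hypothesis bg : bounded_variation 0 1 g.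

Lemma var_part_nondecreasing : {homo var_part g : x y / x <= y}.
Proof.
move=> x y xy; apply: (fine_neg_tv_nondecreasing bg) => //;
  by [exact: clamp01_itv|exact: clamp01_le].
Qed.

Lemma var_part_right_continuous : right_continuous (var_part g).
Proof.
move=> x; have [x0|x0] := ltP x 0.
  apply: cvg_near_cst.
  near=> y; rewrite /var_part/=.
  have y0 : y <= 0 by near: y; exact: nbhs_right_le.
  by rewrite /clamp01 !(max_idPl _)// ge_min ?y0 // ltW.
have [x1|x1] := leP 1 x.
  apply: cvg_near_cst; near=> y; rewrite /var_part/=.
  have xy : x <= y by near: y; exact: nbhs_right_ge.
  by rewrite /clamp01 !(min_idPr _)// (le_trans x1).
have gx : g @ x^'+ --> g x.
  have /(continuous_within_itvP _ ltr01)[ci c0 _] := cg.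
  move: x0; rewrite le_eqVlt => /predU1P[<-//|x0].
  by apply: cvg_within_filter; apply: ci; rewrite in_itv/= x0.
have := neg_tv_right_continuous x0 x1 bg gx.
rewrite -[X in _ --> fine (neg_tv 0 g X)]clamp01_id; last first.
  by rewrite in_itv/= x0 ltW.
apply: cvg_trans; apply: near_eq_cvg; near=> y.
rewrite /var_part/= clamp01_id// in_itv/=; apply/andP; split.
  by rewrite (le_trans x0)//; near: y; exact: nbhs_right_ge.
by near: y; exact: nbhs_right_le.
Unshelve. all: by end_near. Qed.

HB.instance Definition _ := isCumulative.Build R _ R (var_part g)
  var_part_nondecreasing var_part_right_continuous.

Definition var_cumulative : cumulative R R := var_part g.

End cumulative_var_part.

Lemma within_continuousN (A : set R) g :
  {within A, continuous g} -> {within A, continuous (\- g)}.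
Proof. by move=> cg x; apply: cvgN; exact: cg. Qed.

Lemma ls_measure_itv_oc (F : cumulative R R) (a b : R) : a <= b ->
  lebesgue_stieltjes_measure F `]a, b] = (F b - F a)%:E.
Proof.
move=> ab; rewrite /lebesgue_stieltjes_measure/= /measure_extension/=.
rewrite measurable_mu_extE/=; last exact: is_ocitv.
rewrite wlength_itv/= lte_fin; case: ltgtP ab => // -> _.
by rewrite subrr.
Qed.

Section ls_integral.
Variable g : R -> R.
Hypothesis cg : {within `[0, 1], continuous g}.
Hypothesis bg : bounded_variation 0 1 g.

Definition ls_pos :=
  lebesgue_stieltjes_measure
    (var_cumulative (within_continuousN cg) (bounded_variationN bg)).

Definition ls_neg := lebesgue_stieltjes_measure (var_cumulative cg bg).

Definition ls_integral (A : set R) h : R :=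
  \int[ls_pos]_(x in A) h x - \int[ls_neg]_(x in A) h x.

Lemma ls_integral_itv_oc (a b : R) :
  0 <= a -> a <= b -> b <= 1 ->
  ls_integral `]a, b] (cst 1) = g b - g a.
Proof.
move=> a0 ab b1; rewrite /ls_integral /= !Rintegral_cst ?mul1r//.
have a01 : a \in `[0, 1] by rewrite in_itv/= a0 (le_trans ab).
have b01 : b \in `[0, 1] by rewrite in_itv/= b1 (le_trans a0).
rewrite [X in fine X - _](ls_measure_itv_oc _ ab) [X in _ - fine X](ls_measure_itv_oc _ ab) /var_cumulative/= /var_part/= !clamp01_id//.
rewrite (bounded_variation_pos_neg_tvE bg a01).
rewrite (bounded_variation_pos_neg_tvE bg b01) /= /pos_tv.
by rewrite opprB [in RHS]opprB addrACA [in RHS]addrACA; congr (_ + _); rewrite addrC.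
Qed.

End ls_integral.
End LebesgueStieltjesIntegral.

Section Path.
Context {R : realType} {d : nat}.
Implicit Types (gamma : R -> 'rV[R]_d) (v : 'rV[R]_d).

(* The library's norm on 'rV[R]_d is the sup norm. *)
Definition enorm v : R := Num.sqrt (\sum_(i < d) v ord0 i ^+ 2).

Definition path_variation a b gamma (s : seq R) : R :=
  let F := gamma \o nth b (a :: s) in
  \sum_(0 <= n < size s) enorm (F n.+1 - F n).

Definition path_bounded_variation a b gamma :=
  has_ubound [set path_variation a b gamma s | s in itv_partition a b].

Definition path_coord gamma (i : 'I_d) : R -> R := fun t => gamma t ord0 i.

Lemma path_coord_continuous gamma (A : set R) i :
  {within A, continuous gamma} -> {within A, continuous (path_coord gamma i)}.
Proof.
move=> cgamma x; apply: (@cvg_comp _ _ _ gamma (fun v => v ord0 i)).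
  exact: cgamma.
exact: coord_continuous.
Qed.

Lemma coord_le_enorm v i : `|v ord0 i| <= enorm v.
Proof.
rewrite -sqrtr_sqr ler_sqrt; last by apply: sumr_ge0 => j _; exact: sqr_ge0.
by rewrite (bigD1 i)//= lerDl; apply: sumr_ge0 => j _; exact: sqr_ge0.
Qed.

Lemma path_coord_bounded_variation gamma a b i :
  path_bounded_variation a b gamma -> bounded_variation a b (path_coord gamma i).
Proof.
move=> [M gM]; exists M => _ [s abs <-].
apply: (@le_trans _ _ (path_variation a b gamma s)); last by apply: gM; exists s.
apply: ler_sum => n _ /=; rewrite /path_coord.
by apply: le_trans (coord_le_enorm _ i); rewrite !mxE.
Qed.

End Path.

Section TensorSeries.
Context {R : realType} {d : nat}.

(* Coordinates in the basis e_{w_1} (x) ... (x) e_{w_n} of the n-th tensor power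
   of R^d. *)
Definition tensor n := {ffun n.-tuple 'I_d -> R}.

(* An element of the product of all tensor powers: its value at a word of
   length n is a coordinate of its n-th component. *)
Definition tseries := seq 'I_d -> R.

Implicit Types xi eta : tseries.

Definition tcomponent xi n : tensor n := [ffun w : n.-tuple 'I_d => xi w].

Definition tone : tseries := fun w => (w == [::])%:R.

Definition tmul xi eta : tseries :=
  fun w => \sum_(k < (size w).+1) xi (take k w) * eta (drop k w).

Definition tpow xi n : tseries := iter n (tmul xi) tone.

(* The terms of the logarithm with n > size w are left out; they vanish by
   [tpow_subr1_eq0] when xi [::] = 1. *)
Definition tlog xi : tseries := fun w =>
  \sum_(1 <= n < (size w).+1)
    (-1) ^+ n.-1 / n%:R * tpow (fun u => xi u - tone u) n w.

Lemma tpow_subr1_eq0 xi n w : xi [::] = 1 -> (size w < n)%N ->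
  tpow (fun u => xi u - tone u) n w = 0.
Proof.
move=> xi1; elim: n w => // n IHn w wn; rewrite /tpow iterS -/(tpow _ n) {1}/tmul.
rewrite big1// => -[[|k] /= kw] _; first by rewrite take0 xi1 /tone subrr mul0r.
rewrite IHn ?mulr0// size_drop; case: w wn kw => // i w wn _.
by rewrite subSS (leq_ltn_trans (leq_subr _ _)).
Qed.

Definition elem_tensor n (v : 'I_n -> 'rV[R]_d) : tensor n :=
  [ffun w : n.-tuple 'I_d => \prod_(k < n) v k ord0 (tnth w k)].

(* In degree 0, where the tensor power is the ground field and the only
   elementary tensor is 1, the norm is the absolute value. *)
Definition proj_norm n : tensor n -> R :=
  match n with
  | 0 => fun x => `|x [tuple]|
  | n'.+1 => fun x =>
    inf [set r | exists (m : nat) (v : 'I_m -> 'I_n'.+1 -> 'rV[R]_d),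
           x = \sum_(j < m) elem_tensor (v j) /\
           r = \sum_(j < m) \prod_(k < n'.+1) enorm (v j k)]
  end.

Definition power_series_radius (a : R^nat) : \bar R :=
  ereal_sup [set `|z|%:E | z in [set z : R | cvgn (pseries a z)]].

Definition tradius xi : \bar R :=
  power_series_radius (fun n => proj_norm (tcomponent xi n)).

End TensorSeries.
Arguments tseries : clear implicits.

Section Signature.
Context {R : realType} {d : nat}.
Variable gamma : R -> 'rV[R]_d.
Hypothesis cgamma : {within `[0, 1], continuous gamma}.
Hypothesis bgamma : path_bounded_variation 0 1 gamma.

Definition coord_integral (i : 'I_d) (A : set R) (h : R -> R) : R :=
  ls_integral (path_coord_continuous (i := i) cgamma)
              (path_coord_bounded_variation i bgamma) A h.

(* The letters are listed from the outermost integral inwards, that is, from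
   the last integration variable to the first one. *)
Fixpoint iterated_integral (s : R) (rw : seq 'I_d) (t : R) : R :=
  if rw is i :: rw' then coord_integral i `]s, t[ (iterated_integral s rw')
  else 1.

Definition signature (s t : R) : tseries R d :=
  fun w => iterated_integral s (rev w) t.

End Signature.

(* Main.v *)
Require Import Defs.
From mathcomp Require Import all_boot all_order all_algebra.
From mathcomp Require Import boolp classical_sets functions set_interval.
From mathcomp Require Import reals ereal topology normedtype sequences.
From mathcomp Require Import realfun exp trigo derive numfun measure.
From mathcomp Require Import measurable_realfun lebesgue_measure.
From mathcomp Require Import lebesgue_stieltjes_measure lebesgue_integral.
From mathcomp Require Import ring lra.
Set Implicit Arguments.
Unset Strict Implicit.
Unset Printing Implicit Defensive.
Import Order.TTheory GRing.Theory Num.Theory.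
Import numFieldNormedType.Exports.
Local Open Scope classical_set_scope.
Local Open Scope ring_scope.

(* For real linear forms x = a.gamma and y = b.gamma, develop the path into
   upper triangular matrices, sending the letter i to [[a_i z, b_i], [0, 0]].
   With X = x_t - x_s, the signature over [s, t] goes to
   [[exp (z X), int exp (z (x_u - x_s)) dy_u], [0, 1]] and its logarithm to
   [[z X, B], [0, 0]], so that
     z X * int_s^t exp (z (x_u - x_s)) dy_u = (exp (z X) - 1) * B (z).
   If B is entire, evaluating at z = 2 i pi / X and taking real parts gives
     int_s^t cos (2 pi (x_u - x_s) / (x_t - x_s)) dy_u = 0   if x_s <> x_t.
   Differentiating in t shows that near any time T with x_T <> x_s for some
   s < T, dy = q dx up to an error o(1) relative to the total variation.
   Suppose that gamma is not contained in a line on [0, T]. Some coordinate x is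
   not constant there, every other coordinate satisfies dy = q_y dx at T, and
   some y - q_y x is not constant on [0, T] either; exchanging the roles,
   dx = q' d(y - q_y x) = o(1). Hence the variation of gamma is o of itself near
   T, so gamma is constant near T; this is contradictory at the infimum of the
   times T until which gamma is not contained in a line. *)

(** * Integration against a continuous function of bounded variation *)

Section stieltjes_measure.
Context {R : realType}.
Variable F : cumulative R R.
Implicit Types (s t u : R) (h : R -> R).
Local Notation mu := (lebesgue_stieltjes_measure F).

Lemma within_continuousS h (A B : set R) : A `<=` B ->
  {within B, continuous h} -> {within A, continuous h}.
Proof. by move=> AB; exact: continuous_subspaceW. Qed.

Lemma ls_measure_itv_oo_le s t : s <= t -> (mu `]s, t[ <= (F t - F s)%:E)%E.
Proof.
move=> st; rewrite -ls_measure_itv_oc//; apply: le_measure; rewrite ?inE//.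
by move=> x; rewrite /= !in_itv/= => /andP[-> /ltW].
Qed.

Lemma ls_integrable h s t : s <= t -> {within `[s, t], continuous h} ->
  mu.-integrable `]s, t[ (EFin \o h).
Proof.
move=> st ch.
have [M [_ Mh]] : [bounded h x | x in `[s, t]].
  have /compact_bounded[M [_ Mh]] := continuous_compact ch (@segment_compact _ s t).
  by exists M; split; rewrite ?num_real // => ? ? ? ?; exact: Mh.
have sub : `]s, t[ `<=` `[s, t] := @subset_itv_oo_cc _ _ _ _.
apply: measurable_bounded_integrable => //=.
- by rewrite (le_lt_trans (ls_measure_itv_oo_le st))// ltry.
- apply: (@measurable_funS _ _ _ _ `[s, t]) => //.
  exact: subspace_continuous_measurable_fun.
- by exists M; split; rewrite ?num_real // => x Mx y /sub; exact: Mh.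
Qed.

Lemma ls_RintegralD h k s t : s <= t -> {within `[s, t], continuous h} ->
  {within `[s, t], continuous k} ->
  \int[mu]_(u in `]s, t[) (h u + k u) =
  \int[mu]_(u in `]s, t[) h u + \int[mu]_(u in `]s, t[) k u.
Proof. by move=> st ch ck; rewrite RintegralD//; exact: ls_integrable. Qed.

Lemma ls_RintegralZ h s t (c : R) : s <= t -> {within `[s, t], continuous h} ->
  \int[mu]_(u in `]s, t[) (c * h u) = c * \int[mu]_(u in `]s, t[) h u.
Proof. by move=> st ch; rewrite RintegralZl//; exact: ls_integrable. Qed.

Lemma le_ls_Rintegral h s t (M : R) : s <= t -> {within `[s, t], continuous h} ->
  0 <= M -> (forall u, s < u < t -> `|h u| <= M) ->
  `|\int[mu]_(u in `]s, t[) h u| <= M * (F t - F s).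
Proof.
move=> st ch M0 hM; have ih := ls_integrable st ch.
have fin : (mu `]s, t[ < +oo)%E.
  by rewrite (le_lt_trans (ls_measure_itv_oo_le st))// ltry.
apply: (le_trans (le_normr_Rintegral _ ih)) => //.
apply: (@le_trans _ _ (\int[mu]_(u in `]s, t[) cst M u)).
  apply: le_Rintegral => //; first exact: integrable_norm.
  apply: ls_integrable => //; apply: continuous_subspaceT => x; exact: cvg_cst.
rewrite Rintegral_cst// ler_wpM2l// -lee_fin fineK ?ls_measure_itv_oo_le//.
by rewrite ge0_fin_numE.
Qed.

(** The point lies in []u, t]], whose mass [F t - F u] vanishes as [u] increases to [t]: left
    continuity excludes an atom. *)
Lemma ls_measure_set1 t : F u @[u --> t^'-] --> F t -> mu [set t] = 0%E.
Proof.
move=> cF; apply/eqP; rewrite eq_le measure_ge0 andbT.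
apply/lee_addgt0Pr => e e0; rewrite add0e.
have /cvgrPdist_le/(_ _ e0) {}cF := cF.
near (t^'-)%R => u.
have ut : u < t by near: u; exact: nbhs_left_lt.
apply: (@le_trans _ _ (mu `]u, t])).
  apply: le_measure; rewrite ?inE//.
  by move=> _ ->; rewrite /= in_itv/= ut lexx.
rewrite [leLHS]ls_measure_itv_oc ?(ltW ut)// lee_fin.
by rewrite (le_trans (ler_norm _))//; near: u.
Unshelve. all: by end_near. Qed.

Lemma ls_measure_itv_oo s t : s < t -> F u @[u --> t^'-] --> F t ->
  mu `]s, t[ = (F t - F s)%:E.
Proof.
move=> st Ft; rewrite -ls_measure_itv_oc ?ltW//.
have -> : `]s, t]%classic = `]s, t[ `|` [set t] :> set R.
  by rewrite (@setUitv1 _ _ _ _ true).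
rewrite [RHS]measureU//= ?ls_measure_set1// ?adde0//.
by rewrite -subset0 => x [] /= /[swap] ->; rewrite in_itv/= ltxx andbF.
Qed.

Lemma ls_Rintegral_cst1 s t : s < t -> F u @[u --> t^'-] --> F t ->
  \int[mu]_(u in `]s, t[) cst 1 u = F t - F s.
Proof.
move=> st Ft; rewrite Rintegral_cst// mul1r.
by rewrite [X in fine X](ls_measure_itv_oo st Ft).
Qed.

(** The two open intervals miss only the point [t], which carries no mass. *)
Lemma ls_Rintegral_split h s t u : s <= t -> t < u ->
  {within `[s, u], continuous h} -> F u @[u --> t^'-] --> F t ->
  \int[mu]_(x in `]s, u[) h x =
  \int[mu]_(x in `]s, t[) h x + \int[mu]_(x in `]t, u[) h x.
Proof.
move=> st tu ch Ft; have su := le_trans st (ltW tu).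
have ih := ls_integrable su ch.
move: st; rewrite le_eqVlt => /predU1P[<-|st].
  by rewrite set_itvoo0 Rintegral_set0 add0r.
have e : `]s, u[%classic = `]s, t] `|` `]t, u[ :> set R.
  rewrite -itv_bndbnd_setU// bnd_simp; exact: ltW.
have e' : `]s, t]%classic = `]s, t[ `|` [set t] :> set R.
  by rewrite (@setUitv1 _ _ _ _ true).
rewrite e Rintegral_setU//; last 2 first.
- by rewrite -e.
- apply/disj_set2P; rewrite -subset0 => x [] /=; rewrite !in_itv/=.
  by move=> /andP[_ /le_lt_trans lt] /andP[/lt]; rewrite ltxx.
have it : mu.-integrable `]s, t] (EFin \o h).
  by apply: integrableS ih => //; rewrite e; exact: subsetUl.
congr (_ + _).
rewrite e' Rintegral_setU//; last 2 first.
- by rewrite -e'.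
- by apply/disj_set2P; rewrite -subset0 => x [] /= +  xt; rewrite xt in_itv/= ltxx andbF.
rewrite /Rintegral [X in _ + fine X]null_set_integral ?addr0//.
- apply: (@measurable_int _ _ _ mu); apply: integrableS it => //.
  by rewrite e'; exact: subsetUr.
- exact: ls_measure_set1.
Qed.

End stieltjes_measure.

(** * Total variation and the Jordan parts *)

Section total_variation_function.
Context {R : realType}.
Variable g : R -> R.
Hypothesis cg : {within `[0, 1], continuous g}.
Hypothesis bg : bounded_variation 0 1 g.

Definition tvar (t : R) : R := fine (total_variation 0 t g).

Lemma total_variation_fin_num s t : 0 <= s -> s <= t -> t <= 1 ->
  total_variation s t g \is a fin_num.
Proof.
move=> s0 st t1; apply/bounded_variationP => //.
apply: (bounded_variationl (b := 1)) => //.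
by apply: (bounded_variationr s0) => //; exact: le_trans t1.
Qed.

Lemma tvarB s t : 0 <= s -> s <= t -> t <= 1 ->
  tvar t - tvar s = fine (total_variation s t g).
Proof.
move=> s0 st t1; rewrite /tvar (@total_variationD _ 0 t s)// fineD; last 2 first.
- by rewrite total_variation_fin_num// (le_trans st).
- exact: total_variation_fin_num.
by rewrite addrC addKr.
Qed.

Lemma le_norm_tvar s t : 0 <= s -> s <= t -> t <= 1 ->
  `|g t - g s| <= tvar t - tvar s.
Proof.
move=> s0 st t1; rewrite tvarB// -lee_fin fineK ?total_variation_fin_num//.
exact: total_variation_ge.
Qed.

Lemma tvar_continuous : {within `[0, 1], continuous tvar}.
Proof. exact: total_variation_continuous. Qed.

Lemma var_partE t : 0 <= t -> t <= 1 -> var_part g t = (tvar t - g t) / 2.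
Proof.
move=> t0 t1; rewrite /var_part/= clamp01_id ?in_itv/= ?t0//.
by rewrite /neg_tv -(fineK (total_variation_fin_num _ t0 t1))//.
Qed.

(** The total variation of a continuous function is continuous, hence so are the Jordan parts;
    without atoms, integrals over open intervals add up. *)
Lemma var_part_left_continuous t : 0 < t -> t <= 1 ->
  var_part g u @[u --> t^'-] --> var_part g t.
Proof.
move=> t0 t1; rewrite var_partE ?(ltW t0)//.
have left (f : R -> R) : {within `[0, 1], continuous f} ->
    f u @[u --> t^'-] --> f t.
  move=> /(continuous_within_itvP _ ltr01)[ci _ c1].
  move: t1; rewrite le_eqVlt => /predU1P[->//|t1].
  by apply: cvg_at_left_filter; apply: ci; rewrite in_itv/= t0.
apply: (@cvg_trans _ ((tvar u - g u) / 2 @[u --> t^'-])); last first.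
  apply: cvgMl; apply: cvgB; apply: left => //; exact: tvar_continuous.
apply: near_eq_cvg; near=> u.
rewrite var_partE//.
  by near: u; exact: nbhs_left_ge.
by rewrite (le_trans _ t1)//; near: u; exact: nbhs_left_le.
Unshelve. all: by end_near. Qed.

End total_variation_function.

Section ls_integral_theory.
Context {R : realType}.
Variable g : R -> R.
Hypothesis cg : {within `[0, 1], continuous g}.
Hypothesis bg : bounded_variation 0 1 g.
Local Notation I s t h := (ls_integral cg bg `]s, t[ h).
Implicit Types (s t u : R) (h k : R -> R).

Let tvarN t : tvar (\- g) t = tvar g t.
Proof. by rewrite /tvar total_variationN. Qed.

Let var_partN_left_continuous t : 0 < t -> t <= 1 ->
  var_part (\- g) u @[u --> t^'-] --> var_part (\- g) t.
Proof.
apply: var_part_left_continuous; first exact: within_continuousN.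
exact: bounded_variationN.
Qed.

Lemma ls_integral_oo0 t h : I t t h = 0.
Proof. by rewrite set_itvoo0 /ls_integral !Rintegral_set0 subrr. Qed.

Lemma ls_integralD s t h k : s <= t ->
  {within `[s, t], continuous h} -> {within `[s, t], continuous k} ->
  I s t (fun u => h u + k u) = I s t h + I s t k.
Proof.
move=> st ch ck; rewrite /ls_integral.
rewrite [X in X - _](ls_RintegralD _ st ch ck) [X in _ - X = _](ls_RintegralD _ st ch ck).
by rewrite opprD addrACA.
Qed.

Lemma ls_integralZ s t h c : s <= t -> {within `[s, t], continuous h} ->
  I s t (fun u => c * h u) = c * I s t h.
Proof.
move=> st ch; rewrite /ls_integral.
rewrite [X in X - _](ls_RintegralZ _ c st ch) [X in _ - X = _](ls_RintegralZ _ c st ch).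
by rewrite mulrBr.
Qed.

Lemma eq_ls_integral s t h k : (forall u, s < u < t -> h u = k u) ->
  I s t h = I s t k.
Proof.
move=> hk; congr (_ - _); apply: eq_Rintegral => u; rewrite inE/= in_itv/=;
  exact: hk.
Qed.

(** The increments of the two Jordan parts, (V + g) / 2 and (V - g) / 2, sum to that of the total
    variation V. *)
Lemma le_ls_integral s t h (M : R) : 0 <= s -> s <= t -> t <= 1 ->
  {within `[s, t], continuous h} -> 0 <= M ->
  (forall u, s < u < t -> `|h u| <= M) ->
  `|I s t h| <= M * (tvar g t - tvar g s).
Proof.
move=> s0 st t1 ch M0 hM.
have s1 := le_trans st t1; have t0 := le_trans s0 st.
apply: (le_trans (ler_normB _ _)).
apply: (@le_trans _ _ (M * (var_part (\- g) t - var_part (\- g) s) +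
                       M * (var_part g t - var_part g s))).
  by apply: lerD; exact: le_ls_Rintegral.
have bNg := bounded_variationN bg.
by rewrite !var_partE// !tvarN -mulrDr ler_wpM2l//=; lra.
Qed.

Lemma ls_integral_cst s t : 0 <= s -> s <= t -> t <= 1 ->
  I s t (cst 1) = g t - g s.
Proof.
move=> s0; rewrite le_eqVlt => /predU1P[<-|st] t1.
  by rewrite ls_integral_oo0 subrr.
have t0 := le_lt_trans s0 st.
have lp := var_partN_left_continuous t0 t1.
have ln := var_part_left_continuous cg bg t0 t1.
rewrite /ls_integral [X in X - _](ls_Rintegral_cst1 st lp).
rewrite [X in _ - X = _](ls_Rintegral_cst1 st ln) /=.
have bNg := bounded_variationN bg; have s1 := le_trans (ltW st) t1.
by rewrite !var_partE ?(ltW t0)// !tvarN /=; lra.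
Qed.

Lemma ls_integral_split s t u h : 0 <= s -> s <= t -> t <= u -> u <= 1 ->
  {within `[s, u], continuous h} ->
  I s u h = I s t h + I t u h.
Proof.
move=> s0; rewrite le_eqVlt => /predU1P[<-|st] + u1 ch.
  by rewrite ls_integral_oo0 add0r.
rewrite le_eqVlt => /predU1P[<-|tu].
  by rewrite ls_integral_oo0 addr0.
have t0 := le_lt_trans s0 st; have t1 := ltW (lt_le_trans tu u1).
have lp := var_partN_left_continuous t0 t1.
have ln := var_part_left_continuous cg bg t0 t1.
rewrite /ls_integral [X in X - _](ls_Rintegral_split (ltW st) tu ch lp).
by rewrite [X in _ - X = _](ls_Rintegral_split (ltW st) tu ch ln) opprD addrACA.
Qed.

End ls_integral_theory.

(** * Continuity and increments on an interval *)

Section within_continuity.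
Context {R : realType}.
Implicit Types (f W : R -> R) (s t u v p : R).

Lemma within_continuousP f s t : {within `[s, t], continuous f} <->
  (forall p e, s <= p <= t -> 0 < e -> exists2 r, 0 < r &
     forall u, s <= u <= t -> `|p - u| < r -> `|f p - f u| < e).
Proof.
split=> [/subspace_continuousP cf p e pst e0|cf].
  have /cvgrPdist_lt/(_ e e0) : f u @[u --> within `[s, t] (nbhs p)] --> f p.
    by apply: cf; rewrite /= in_itv.
  rewrite near_withinE => /nbhs_ballP[r /= r0 pr]; exists r => // u ust pu.
  by apply: (pr u) => //; rewrite /= in_itv.
apply/subspace_continuousP => p; rewrite /= in_itv/= => pst.
apply/cvgrPdist_lt => e e0; rewrite near_withinE.
have [r r0 pr] := cf p e pst e0.
apply/nbhs_ballP; exists r => //= u pu; rewrite in_itv/= => ust.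
exact: pr.
Qed.

Lemma within_continuous_comp f (phi : R -> R) (A : set R) : continuous phi ->
  {within A, continuous f} -> {within A, continuous (fun u => phi (f u))}.
Proof. by move=> cphi cf x; apply: continuous_comp; [exact: cf|exact: cphi]. Qed.

Lemma within_continuous_cst c (A : set R) :
  {within A, continuous (fun=> c : R)}.
Proof. by apply: continuous_subspaceT => x; exact: cvg_cst. Qed.

Lemma within_continuousZ f c (A : set R) :
  {within A, continuous f} -> {within A, continuous (fun u => c * f u)}.
Proof. exact/within_continuous_comp/mulrl_continuous. Qed.

Lemma within_continuousD f g (A : set R) : {within A, continuous f} ->
  {within A, continuous g} -> {within A, continuous (fun u => f u + g u)}.
Proof. by move=> cf cg x; apply: cvgD; [exact: cf|exact: cg]. Qed.

Lemma within_continuousB f g (A : set R) : {within A, continuous f} ->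
  {within A, continuous g} -> {within A, continuous (fun u => f u - g u)}.
Proof. by move=> cf cg x; apply: cvgB; [exact: cf|exact: cg]. Qed.

Lemma within_continuous_sum (I : Type) (r : seq I) (f : I -> R -> R)
    (A : set R) :
  (forall i, {within A, continuous (f i)}) ->
  {within A, continuous (fun t => \sum_(i <- r) f i t)}.
Proof.
move=> cf; elim: r => [|i r IHr].
  under eq_fun do rewrite big_nil; exact: within_continuous_cst.
under eq_fun do rewrite big_cons; exact: within_continuousD.
Qed.

Lemma within_continuous_dominated f W s t C : {within `[s, t], continuous W} ->
  (forall u v, s <= u -> u <= v -> v <= t -> `|f v - f u| <= C * (W v - W u)) ->
  {within `[s, t], continuous f}.
Proof.
move=> /within_continuousP cW fW; apply/within_continuousP => p e pst e0.
have C1 : 0 < `|C| + 1 by rewrite ltr_wpDl.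
have [r r0 pr] := cW p (e / (`|C| + 1)) pst (divr_gt0 e0 C1).
exists r => // u ust /(pr _ ust); rewrite ltr_pdivlMr// => {pr} We.
have key x y : s <= x -> x <= y -> y <= t ->
    `|f y - f x| <= `|W y - W x| * (`|C| + 1).
  move=> sx xy yt; apply: (le_trans (fW _ _ sx xy yt)).
  rewrite (le_trans (ler_norm _))// normrM mulrC ler_wpM2l// lerDl; exact: ler01.
have /andP[sp pt] := pst; have /andP[su ut] := ust.
case: (leP p u) => [pu|/ltW up].
  by rewrite distrC (le_lt_trans (key _ _ _ pu _))// distrC.
by rewrite (le_lt_trans (key _ _ _ up _)).
Qed.

(** Continuous induction: the supremum of the times reached by the bound from [s] satisfies it too,
    and the local bound there would carry it further if that time were below [t]. *)
Lemma locally_dominated_increments f W s t : s <= t ->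
  (forall p, s <= p <= t -> exists2 r, 0 < r &
    forall u v, s <= u -> u <= v -> v <= t -> `|p - u| < r -> `|p - v| < r ->
      `|f v - f u| <= W v - W u) ->
  `|f t - f s| <= W t - W s.
Proof.
move=> st loc; pose A := [set v | s <= v <= t /\ `|f v - f s| <= W v - W s].
have As : A s by rewrite /A/= lexx st !subrr normr0.
have ubA : ubound A t by move=> v [/andP[]].
have supA : has_sup A by split; [exists s|exists t].
have sc : s <= sup A by exact: (ubP _ _).1 (sup_upper_bound supA) _ As.
have ct : sup A <= t by apply: ge_sup => //; exists s.
have [|r r0 cr] := loc (sup A); first by rewrite sc.
have [v [/andP[sv vt] Av] cv] := sup_adherent r0 supA.
have vc : v <= sup A.
  by apply: (ubP _ _).1 (sup_upper_bound supA) _ _; rewrite /A/= sv vt.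
have Aw w : sup A <= w -> w <= t -> `|sup A - w| < r -> A w.
  move=> cw wt wr; split; first by rewrite (le_trans sc).
  have vw := le_trans vc cw.
  have := cr v w sv vw wt _ wr.
  rewrite ger0_norm ?subr_ge0// ltrBlDr -ltrBlDl => /(_ cv) {}cr.
  have -> : f w - f s = (f w - f v) + (f v - f s) by ring.
  by apply: (le_trans (ler_normD _ _)); move: cr Av; lra.
have cA : A (sup A) by apply: Aw => //; rewrite subrr normr0.
have [tc|ct'] := leP t (sup A).
  by have e : sup A = t; [apply/eqP; rewrite eq_le tc ct|case: cA; rewrite e].
pose w := Num.min t (sup A + r / 2).
have cw : sup A < w by rewrite lt_min ct' ltrDl divr_gt0.
have : A w.
  apply: Aw; [exact: ltW|by rewrite ge_min lexx|].
  rewrite distrC ger0_norm ?subr_ge0 ?ltW// ltrBlDl.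
  by rewrite gt_min ltrD2l ltr_pdivrMr// ltr_pMr// ltr1n orbT.
by move=> /(ubP _ _).1 - /(_ _ (sup_upper_bound supA)); rewrite leNgt cw.
Qed.

(** Local errors that are o(dW) at every point accumulate to nothing: the previous lemma with a
    small multiple of [W] makes the total increment arbitrarily small. *)
Lemma locally_constant_increments f W s t : s <= t ->
  (forall e p, 0 < e -> s <= p <= t -> exists2 r, 0 < r &
    forall u v, s <= u -> u <= v -> v <= t -> `|p - u| < r -> `|p - v| < r ->
      `|f v - f u| <= e * (W v - W u)) ->
  f t = f s.
Proof.
move=> st loc; apply/eqP; rewrite -subr_eq0 -normr_le0.
apply/ler_addgt0Pr => e e0; rewrite add0r.
have W1 : 0 < `|W t - W s| + 1 by rewrite ltr_wpDl.
have eW := divr_gt0 e0 W1.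
suff : `|f t - f s| <= e / (`|W t - W s| + 1) * W t - e / (`|W t - W s| + 1) * W s.
  rewrite -mulrBr => /le_trans; apply.
  apply: (@le_trans _ _ (e / (`|W t - W s| + 1) * (`|W t - W s| + 1))).
    by rewrite ler_wpM2l ?(ltW eW)// (le_trans (ler_norm _))// lerDl.
  by rewrite divfK ?gt_eqF.
apply: (@locally_dominated_increments _ (fun u => e / (`|W t - W s| + 1) * W u)) => // p pst.
have [r r0 pr] := loc _ p eW pst; exists r => // u v *.
  by rewrite -mulrBr; exact: pr.
Qed.

Lemma dist_between_lt u v w p e : u <= w -> w <= v ->
  `|p - u| < e -> `|p - v| < e -> `|p - w| < e.
Proof.
move=> uw wv; rewrite !ltr_norml => /andP[? ?] /andP[? ?].
by apply/andP; split; lra.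
Qed.

(** The order of [x] and [y] is left open, so the position of [z] between them is recorded by its
    distances to arbitrary points. *)
Lemma MVT_between (phi dphi : R -> R) (x y : R) :
  (forall z : R, is_derive z 1 phi (dphi z)) ->
  exists2 z, (forall p, `|p - z| <= Num.max `|p - x| `|p - y|) &
    phi y - phi x = dphi z * (y - x).
Proof.
move=> dp; have cphi : continuous phi.
  by move=> z; apply/differentiable_continuous/derivable1_diffP.
have between u v z p : u <= z -> z <= v ->
    `|p - z| <= Num.max `|p - u| `|p - v|.
  move=> uz zv; rewrite le_max; have [pz|zp] := leP p z.
    by apply/orP; right; rewrite !ler0_norm; lra.
  by apply/orP; left; rewrite !ger0_norm; lra.
have [xy|/ltW yx] := leP x y.
  have [|z zi ->] := @MVT_segment _ phi dphi x y xy (fun z _ => dp z).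
    exact: continuous_subspaceT.
  by exists z => // p; move: zi; rewrite in_itv/= => /andP[xz zy]; exact: between.
have [|z zi E] := @MVT_segment _ phi dphi y x yx (fun z _ => dp z).
  exact: continuous_subspaceT.
exists z; last by rewrite -opprB E -mulrN opprB.
by move=> p; move: zi; rewrite in_itv/= maxC => /andP[xz zy]; exact: between.
Qed.

Lemma is_derive_divided_power (c x : R) n :
  is_derive x 1 (fun y => (y - c) ^+ n.+1 / n.+1`!%:R) ((x - c) ^+ n / n`!%:R).
Proof.
have -> : (fun y => (y - c) ^+ n.+1 / n.+1`!%:R) =
    (n.+1`!%:R^-1 : R) \*: ((id - cst c) ^+ n.+1) :> (R -> R).
  by apply/funext => y; rewrite mulrC /= fctE /GRing.scale.
apply: is_derive_eq.
rewrite /= fctE/= oppr0 addr0 /GRing.scale /= mulr1 factS natrM invfM.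
by rewrite mulrACA mulVf ?pnatr_eq0// mul1r mulrC.
Qed.

End within_continuity.

(** * Line integrals along the path *)

Section path_integral.
Context {R : realType} {d : nat}.
Variable gamma : R -> 'rV[R]_d.
Hypothesis cgamma : {within `[0, 1], continuous gamma}.
Hypothesis bgamma : path_bounded_variation 0 1 gamma.
Implicit Types (a b : 'I_d -> R) (h k : R -> R) (s t u v p c M : R).

Definition lform a t : R := \sum_i a i * path_coord gamma i t.

(** All first-order errors along the path are measured against the increments of this function. *)
Definition pvar t : R := \sum_i tvar (path_coord gamma i) t.

Definition l1norm a : R := \sum_i `|a i|.

(** The Stieltjes integral of [h] against dy, for the linear form y = b.gamma. *)
Definition form_integral b s t h : R :=
  \sum_i b i * coord_integral cgamma bgamma i `]s, t[ h.

Let cgi i : {within `[0, 1], continuous (path_coord gamma i)} :=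
  path_coord_continuous (i := i) cgamma.
Let bgi i : bounded_variation 0 1 (path_coord gamma i) :=
  path_coord_bounded_variation i bgamma.

Lemma l1norm_ge0 a : 0 <= l1norm a.
Proof. exact: sumr_ge0. Qed.

Lemma lform_continuous a : {within `[0, 1], continuous (lform a)}.
Proof.
apply: within_continuous_sum => i; apply: within_continuousZ; exact: cgi.
Qed.

Lemma pvar_continuous : {within `[0, 1], continuous pvar}.
Proof. by apply: within_continuous_sum => i; exact: tvar_continuous. Qed.

Lemma tvarB_le_pvarB i s t : 0 <= s -> s <= t -> t <= 1 ->
  tvar (path_coord gamma i) t - tvar (path_coord gamma i) s <= pvar t - pvar s.
Proof.
move=> s0 st t1; rewrite /pvar -sumrB (bigD1 i)//= lerDl.
apply: sumr_ge0 => j _.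
exact: le_trans (le_norm_tvar (@bgi j) s0 st t1).
Qed.

Lemma pvar_le s t : 0 <= s -> s <= t -> t <= 1 -> pvar s <= pvar t.
Proof.
move=> s0 st t1; rewrite -subr_ge0 /pvar -sumrB; apply: sumr_ge0 => j _.
exact: le_trans (le_norm_tvar (@bgi j) s0 st t1).
Qed.

Lemma lformB a s t :
  lform a t - lform a s =
  \sum_i a i * (path_coord gamma i t - path_coord gamma i s).
Proof. by rewrite /lform -sumrB; apply: eq_bigr => i _; rewrite mulrBr. Qed.

Lemma le_lformB_pvar a s t : 0 <= s -> s <= t -> t <= 1 ->
  `|lform a t - lform a s| <= l1norm a * (pvar t - pvar s).
Proof.
move=> s0 st t1; rewrite lformB (le_trans (ler_norm_sum _ _ _))//.
rewrite mulr_suml; apply: ler_sum => i _; rewrite normrM ler_wpM2l//.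
exact: le_trans (le_norm_tvar (@bgi i) s0 st t1) (tvarB_le_pvarB i s0 st t1).
Qed.

Lemma form_integralD b s t h k : s <= t ->
  {within `[s, t], continuous h} -> {within `[s, t], continuous k} ->
  form_integral b s t (fun u => h u + k u) =
  form_integral b s t h + form_integral b s t k.
Proof.
move=> st ch ck; rewrite /form_integral -big_split; apply: eq_bigr => i _ /=.
by rewrite /coord_integral ls_integralD// mulrDr.
Qed.

Lemma form_integralZ b s t h c : s <= t -> {within `[s, t], continuous h} ->
  form_integral b s t (fun u => c * h u) = c * form_integral b s t h.
Proof.
move=> st ch; rewrite /form_integral mulr_sumr; apply: eq_bigr => i _ /=.
by rewrite /coord_integral ls_integralZ// mulrCA.
Qed.

Lemma form_integralB b s t h k : s <= t ->
  {within `[s, t], continuous h} -> {within `[s, t], continuous k} ->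
  form_integral b s t (fun u => h u - k u) =
  form_integral b s t h - form_integral b s t k.
Proof.
move=> st ch ck; rewrite -mulN1r -form_integralZ// -form_integralD//.
  by congr form_integral; apply/funext => u; rewrite mulN1r.
exact: within_continuousZ.
Qed.

Lemma eq_form_integral b s t h k : (forall u, s < u < t -> h u = k u) ->
  form_integral b s t h = form_integral b s t k.
Proof.
by move=> hk; apply: eq_bigr => i _; congr (_ * _); exact: eq_ls_integral.
Qed.

Lemma form_integral_sum b s t n (h : 'I_n -> R -> R) : s <= t ->
  (forall i, {within `[s, t], continuous (h i)}) ->
  form_integral b s t (fun u => \sum_(i < n) h i u) =
  \sum_(i < n) form_integral b s t (h i).
Proof.
move=> st; elim: n h => [|n IHn] h ch.
  under eq_fun do rewrite big_ord0; rewrite big_ord0.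
  transitivity (form_integral b s t (fun u => 0 * cst (0 : R) u)).
    by congr form_integral; apply/funext => u; rewrite mul0r.
  by rewrite form_integralZ ?mul0r//; exact: within_continuous_cst.
under eq_fun do rewrite big_ord_recr /=.
rewrite form_integralD// ?big_ord_recr/= ?IHn//.
exact: within_continuous_sum.
Qed.

Lemma le_form_integral b s t h M : 0 <= s -> s <= t -> t <= 1 ->
  {within `[s, t], continuous h} -> 0 <= M ->
  (forall u, s < u < t -> `|h u| <= M) ->
  `|form_integral b s t h| <= l1norm b * M * (pvar t - pvar s).
Proof.
move=> s0 st t1 ch M0 hM; rewrite (le_trans (ler_norm_sum _ _ _))//.
rewrite -mulrA mulr_suml; apply: ler_sum => i _; rewrite normrM ler_wpM2l//.
have := le_ls_integral (@cgi i) (@bgi i) s0 st t1 ch M0 hM.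
move=> /le_trans; apply.
by rewrite ler_wpM2l// tvarB_le_pvarB.
Qed.

Lemma form_integral_cst b s t c : 0 <= s -> s <= t -> t <= 1 ->
  form_integral b s t (cst c) = c * (lform b t - lform b s).
Proof.
move=> s0 st t1.
transitivity (form_integral b s t (fun u => c * cst (1 : R) u)).
  by congr form_integral; apply/funext => u; rewrite mulr1.
rewrite form_integralZ//; last by exact: within_continuous_cst.
rewrite lformB; congr (_ * _); apply: eq_bigr => i _; congr (_ * _).
exact: ls_integral_cst.
Qed.

Lemma form_integral_split b s t u h : 0 <= s -> s <= t -> t <= u -> u <= 1 ->
  {within `[s, u], continuous h} ->
  form_integral b s u h = form_integral b s t h + form_integral b t u h.
Proof.
move=> s0 st tu u1 ch; rewrite /form_integral -big_split; apply: eq_bigr => i _ /=.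
by rewrite /coord_integral (ls_integral_split _ _ s0 st tu u1 ch) mulrDr.
Qed.

Lemma within_continuousW h s t s' t' : s <= s' -> t' <= t ->
  {within `[s, t], continuous h} -> {within `[s', t'], continuous h}.
Proof.
move=> ss tt; apply: within_continuousS => x /=; rewrite !in_itv/=.
by move=> /andP[/(le_trans ss) -> /le_trans]; exact.
Qed.

Lemma form_integral_subr_cst b s t h c M : 0 <= s -> s <= t -> t <= 1 ->
  {within `[s, t], continuous h} -> 0 <= M ->
  (forall u, s < u < t -> `|c - h u| <= M) ->
  `|form_integral b s t h - c * (lform b t - lform b s)| <=
  l1norm b * M * (pvar t - pvar s).
Proof.
move=> s0 st t1 ch M0 hM; have cc : {within `[s, t], continuous (cst c)}.
  exact: within_continuous_cst.
rewrite -form_integral_cst// distrC -form_integralB// le_form_integral//.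
exact: within_continuousB.
Qed.

Lemma form_integral_continuous b s h : 0 <= s ->
  {within `[s, 1], continuous h} ->
  {within `[s, 1], continuous (form_integral b s ^~ h)}.
Proof.
move=> s0 ch.
have [M [Mr hM]] : [bounded h x | x in `[s, 1]].
  have /compact_bounded[M [_ Mh]] := continuous_compact ch (@segment_compact _ s 1).
  by exists M; split; rewrite ?num_real // => ? ? ? ?; exact: Mh.
apply: (@within_continuous_dominated _ _ pvar _ _ (l1norm b * (`|M| + 1))).
  exact: within_continuousW pvar_continuous.
move=> u v su uv v1.
rewrite (@form_integral_split b s u v)//; last exact: within_continuousW ch.
rewrite addrAC subrr add0r le_form_integral//.
- exact: le_trans su.
- exact: within_continuousW ch.
move=> w /andP[uw wv]; apply: hM => /=.
  by rewrite (le_lt_trans (ler_norm M))// ltrDl.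
by rewrite in_itv/= (le_trans su (ltW uw)) (le_trans (ltW wv)).
Qed.

(* Chain rule: both sides change by [dphi (x_p) * dx] up to [o(d pvar)] near any
   time [p]. *)
Lemma form_integral_chain a (phi dphi : R -> R) s t :
  0 <= s -> s <= t -> t <= 1 ->
  (forall x : R, is_derive x 1 phi (dphi x)) -> continuous dphi ->
  form_integral a s t (fun u => dphi (lform a u)) =
  phi (lform a t) - phi (lform a s).
Proof.
move=> s0 st t1 dp cdp.
have cx : {within `[0, 1], continuous (fun u => dphi (lform a u))}.
  apply: (@within_continuous_comp _ (lform a) dphi _ cdp).
  exact: lform_continuous.
(* Up to a constant, the difference of the two sides as a function of the upper end point; it is
   shown to be constant. *)
pose f v := form_integral a s v (fun u => dphi (lform a u)) - phi (lform a v).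
suff : f t = f s.
  rewrite /f [X in _ = X - _](_ : _ = 0).
    by move=> /eqP; rewrite sub0r subr_eq addrC => /eqP.
  by rewrite /form_integral big1// => i _; rewrite /coord_integral ls_integral_oo0 mulr0.
apply: (@locally_constant_increments _ _ pvar) => // e p e0 /andP[sp pt].
have A1 : 0 < 2 * (l1norm a + 1).
  by rewrite mulr_gt0// ltr_wpDl// l1norm_ge0.
have p01 : 0 <= p <= 1 by rewrite (le_trans s0)// (le_trans pt).
have [q q0 dq] : exists2 q, 0 < q & forall x, `|lform a p - x| < q ->
    `|dphi (lform a p) - dphi x| < e / (2 * (l1norm a + 1)).
  have /cvgrPdist_lt/(_ _ (divr_gt0 e0 A1)) := cdp (lform a p).
  by move=> /nbhs_ballP[q /= q0 pq]; exists q.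
have [r r0 xr] := (within_continuousP _ _ _).1 (@lform_continuous a) p q p01 q0.
exists r => // u v su uv vt pu pv.
have u0 := le_trans s0 su; have v1 := le_trans vt t1; have u1 := le_trans uv v1.
have v0 := le_trans u0 uv.
rewrite /f (@form_integral_split a s u v)//; last exact: within_continuousW cx.
have [z zp zE] := MVT_between (lform a u) (lform a v) dp.
have zq : `|lform a p - z| < q.
  by rewrite (le_lt_trans (zp _))// gt_max !xr// ?u0 ?v0.
(* The integral over [[u, v]] and the increment of [phi] are both compared with [c] times the
   increment of the form, each at the cost of at most half of the error. *)
set I := form_integral _ u v _; set c := dphi (lform a p).
have -> : form_integral a s u (fun u => dphi (lform a u)) + I - phi (lform a v) -
  (form_integral a s u (fun u => dphi (lform a u)) - phi (lform a u)) =
  (I - c * (lform a v - lform a u)) +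
  (c - dphi z) * (lform a v - lform a u) by rewrite mulrBl -zE; ring.
apply: (le_trans (ler_normD _ _)).
have I1 : `|I - c * (lform a v - lform a u)| <=
    l1norm a * (e / (2 * (l1norm a + 1))) * (pvar v - pvar u).
  apply: form_integral_subr_cst => //.
  - exact: within_continuousW cx.
  - by rewrite ltW// divr_gt0.
  move=> w /andP[uw wv]; rewrite ltW//; apply: dq; apply: xr.
    by rewrite (le_trans u0 (ltW uw)) (le_trans (ltW wv)).
  exact: dist_between_lt (ltW uw) (ltW wv) pu pv.
have I2 : `|(c - dphi z) * (lform a v - lform a u)| <=
    (e / (2 * (l1norm a + 1))) * (l1norm a * (pvar v - pvar u)).
  by rewrite normrM ler_pM// ?le_lformB_pvar// ltW// dq.
apply: (le_trans (lerD I1 I2)).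
have V0 : 0 <= pvar v - pvar u by rewrite subr_ge0 pvar_le.
set V := pvar v - pvar u in V0 *.
have -> : l1norm a * (e / (2 * (l1norm a + 1))) * V + e / (2 * (l1norm a + 1)) * (l1norm a * V)
  = l1norm a / (l1norm a + 1) * (e * V).
  by field; rewrite gt_eqF// ltr_wpDl// l1norm_ge0.
rewrite -[leRHS]mul1r ler_wpM2r ?mulr_ge0// ?(ltW e0)//.
by rewrite ler_pdivrMr ?mul1r ?lerDl// ltr_wpDl// l1norm_ge0.
Qed.

End path_integral.

(** * Image of the signature in triangular matrices *)

Section word_sums.
Context {R : realType} {d : nat}.
Variables a b : 'I_d -> R.
Implicit Types xi eta : tseries R d.

(* The letter [i] is represented by the matrix [[a i * z, b i], [0, 0]]: the
   coefficient of [z ^ n] in the upper left entry of the image of [xi] is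
   [wordA n xi], and that of [z ^ n.-1] in the upper right one is [wordB n xi]. *)
Fixpoint wordA n xi : R :=
  if n is n'.+1 then \sum_i a i * wordA n' (fun w => xi (i :: w)) else xi [::].

Fixpoint wordB n xi : R :=
  match n with
  | 0 => 0
  | 1 => \sum_i b i * xi [:: i]
  | n'.+1 => \sum_i a i * wordB n' (fun w => xi (i :: w))
  end.

Arguments wordB : simpl nomatch.

Lemma eq_wordA n xi eta : xi =1 eta -> wordA n xi = wordA n eta.
Proof. by move=> /funext ->. Qed.

Lemma eq_wordB n xi eta : xi =1 eta -> wordB n xi = wordB n eta.
Proof. by move=> /funext ->. Qed.

Lemma wordA_S n xi :
  wordA n.+1 xi = \sum_i a i * wordA n (fun w => xi (i :: w)).
Proof. by []. Qed.

Lemma wordB_1 xi : wordB 1 xi = \sum_i b i * xi [:: i].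
Proof. by []. Qed.

Lemma wordB_SS n xi :
  wordB n.+2 xi = \sum_i a i * wordB n.+1 (fun w => xi (i :: w)).
Proof. by []. Qed.

Lemma wordAD n xi eta :
  wordA n (fun w => xi w + eta w) = wordA n xi + wordA n eta.
Proof.
elim: n xi eta => //= n IHn xi eta; rewrite -big_split/=.
by apply: eq_bigr => i _; rewrite IHn mulrDr.
Qed.

Lemma wordAZ n c xi : wordA n (fun w => c * xi w) = c * wordA n xi.
Proof.
elim: n xi => //= n IHn xi; rewrite mulr_sumr.
by apply: eq_bigr => i _; rewrite IHn mulrCA.
Qed.

Lemma wordBD n xi eta :
  wordB n (fun w => xi w + eta w) = wordB n xi + wordB n eta.
Proof.
elim: n xi eta => [|[|n] IHn] xi eta; first by rewrite addr0.
  by rewrite -big_split/=; apply: eq_bigr => i _; rewrite mulrDr.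
rewrite !wordB_SS -big_split; apply: eq_bigr => i _ /=.
by rewrite -mulrDr -IHn.
Qed.

Lemma wordBZ n c xi : wordB n (fun w => c * xi w) = c * wordB n xi.
Proof.
elim: n xi => [|[|n] IHn] xi; first by rewrite mulr0.
  by rewrite /= mulr_sumr; apply: eq_bigr => i _; rewrite mulrCA.
rewrite !wordB_SS mulr_sumr; apply: eq_bigr => i _.
by rewrite mulrCA -IHn.
Qed.

Lemma wordB_sum n (I : Type) (r : seq I) (c : I -> R) (xi : I -> tseries R d) :
  wordB n (fun w => \sum_(j <- r) c j * xi j w) =
  \sum_(j <- r) c j * wordB n (xi j).
Proof.
elim: r => [|j r IHr].
  rewrite big_nil (@eq_wordB _ _ (fun w => 0 * tone w)) ?wordBZ ?mul0r// => w.
  by rewrite big_nil mul0r.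
rewrite big_cons -IHr -wordBZ -wordBD.
by apply: eq_wordB => w; rewrite big_cons.
Qed.

Lemma tmul_cons xi eta i w : tmul xi eta (i :: w) =
  xi [::] * eta (i :: w) + tmul (fun u => xi (i :: u)) eta w.
Proof. by rewrite /tmul /= big_ord_recl. Qed.

Lemma wordA_tmul n xi eta :
  wordA n (tmul xi eta) = \sum_(k < n.+1) wordA k xi * wordA (n - k) eta.
Proof.
elim: n xi => [|n IHn] xi.
  by rewrite /= /tmul/= !big_ord1.
rewrite big_ord_recl subn0 /= mulr_sumr.
under [X in _ + X]eq_bigr do rewrite mulr_suml.
rewrite exchange_big -big_split /=; apply: eq_bigr => i _.
rewrite (@eq_wordA _ _ (fun w => xi [::] * eta (i :: w) +
  tmul (fun u => xi (i :: u)) eta w)) => [|w]; last exact: tmul_cons.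
rewrite wordAD wordAZ IHn mulrDr mulrCA mulr_sumr; congr (_ + _).
by apply: eq_bigr => k _; rewrite mulrA.
Qed.

(** In a product of matrices [[A, B], [0, D]] and [[A', B'], [0, D']] the upper right entry is A B'
    + B D'; here D' is the coefficient of the empty word. *)
Lemma wordB_tmul n xi eta : wordB n (tmul xi eta) =
  \sum_(k < n.+1) wordA k xi * wordB (n - k) eta + wordB n xi * eta [::].
Proof.
elim: n xi => [|[|n] IHn] xi.
- by rewrite big_ord1 /= mulr0 mul0r addr0.
- rewrite !big_ord_recl big_ord0 /= mulr0 !addr0.
  rewrite mulr_sumr mulr_suml -big_split /=; apply: eq_bigr => i _.
  by rewrite /tmul /= !big_ord_recl big_ord0 /=; ring.
rewrite big_ord_recl subn0 !wordB_SS mulr_sumr mulr_suml.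
under [X in _ + X + _]eq_bigr do rewrite /= mulr_suml.
rewrite [X in _ + X + _]exchange_big -!big_split /=; apply: eq_bigr => i _.
rewrite (@eq_wordB _ _ (fun w => xi [::] * eta (i :: w) +
  tmul (fun u => xi (i :: u)) eta w)) => [|w]; last exact: tmul_cons.
rewrite -/(wordB n.+1) wordBD wordBZ IHn !mulrDr mulrCA mulr_sumr !addrA.
congr (_ + _ + _); last by rewrite mulrA.
by apply: eq_bigr => k _; rewrite mulrA.
Qed.

(** The defining recursion strips the first letter, whereas the signature is integrated outermost in
    the last one. *)
Lemma wordA_rcons n xi :
  wordA n.+1 xi = \sum_i a i * wordA n (fun w => xi (rcons w i)).
Proof.
elim: n xi => // n IHn xi.
rewrite wordA_S; under eq_bigr do rewrite [X in _ * X]IHn mulr_sumr.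
rewrite exchange_big /=; apply: eq_bigr => i _; rewrite mulr_sumr.
by apply: eq_bigr => j _; rewrite mulrCA.
Qed.

Lemma wordB_rcons n xi :
  wordB n.+1 xi = \sum_i b i * wordA n (fun w => xi (rcons w i)).
Proof.
elim: n xi => // n IHn xi.
rewrite wordB_SS; under eq_bigr do rewrite [X in _ * X]IHn mulr_sumr.
rewrite exchange_big /=; apply: eq_bigr => i _; rewrite mulr_sumr.
by apply: eq_bigr => j _; rewrite mulrCA.
Qed.

End word_sums.

(** * Word sums of the signature *)

Section signature_word_sums.
Context {R : realType} {d : nat}.
Variable gamma : R -> 'rV[R]_d.
Hypothesis cgamma : {within `[0, 1], continuous gamma}.
Hypothesis bgamma : path_bounded_variation 0 1 gamma.
Implicit Types (a b : 'I_d -> R) (s t : R).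

Let coord_integralE i s t h : coord_integral cgamma bgamma i `]s, t[ h =
  form_integral cgamma bgamma (fun j => (j == i)%:R) s t h.
Proof.
rewrite /form_integral (bigD1 i)//= eqxx mul1r big1 ?addr0// => j /negPf ->.
by rewrite mul0r.
Qed.

Lemma iterated_integral_continuous s rw : 0 <= s ->
  {within `[s, 1], continuous (iterated_integral cgamma bgamma s rw)}.
Proof.
move=> s0; elim: rw => [|i rw IHrw]; first exact: within_continuous_cst.
have -> : iterated_integral cgamma bgamma s (i :: rw) =
    (form_integral cgamma bgamma (fun j => (j == i)%:R) s ^~
       (iterated_integral cgamma bgamma s rw)).
  by apply/funext => t; exact: coord_integralE.
exact: form_integral_continuous.
Qed.

(** Continuity is carried through the induction because each step uses linearity of the integral on
    continuous integrands. *)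
Lemma form_integral_wordA a b s t n (G : R -> tseries R d) : s <= t ->
  (forall w, {within `[s, t], continuous (G ^~ w)}) ->
  {within `[s, t], continuous (fun u => wordA a n (G u))} /\
  wordA a n (fun w => form_integral cgamma bgamma b s t (G ^~ w)) =
  form_integral cgamma bgamma b s t (fun u => wordA a n (G u)).
Proof.
move=> st; elim: n G => [|n IHn] G cG; first by split=> //; exact: cG.
have IH i := IHn (fun u w => G u (i :: w)) (fun w => cG (i :: w)).
split.
  by apply: within_continuous_sum => i; apply: within_continuousZ; case: (IH i).
rewrite /= form_integral_sum//; last first.
  by move=> i; apply: within_continuousZ; case: (IH i).
apply: eq_bigr => i _; rewrite form_integralZ//; last by case: (IH i).
by rewrite (IH i).2.
Qed.

Lemma signature_rcons_sum a b s t n : 0 <= s -> s <= t -> t <= 1 ->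
  \sum_i b i * wordA a n (fun w => signature cgamma bgamma s t (rcons w i)) =
  form_integral cgamma bgamma b s t
    (fun u => wordA a n (signature cgamma bgamma s u)).
Proof.
move=> s0 st t1; apply: eq_bigr => i _; congr (_ * _).
rewrite coord_integralE.
have cS w : {within `[s, t], continuous (fun u => signature cgamma bgamma s u w)}.
  have := @iterated_integral_continuous _ (rev w) s0.
  exact: within_continuousW.
rewrite -(form_integral_wordA a _ n st cS).2; apply: eq_wordA => w.
by rewrite /signature rev_rcons /= coord_integralE.
Qed.

(** By the chain rule, integrating (x_u - x_s)^n / n! against dx_u gives the divided power of degree
    n + 1. *)
Lemma wordA_signature a s t n : 0 <= s -> s <= t -> t <= 1 ->
  wordA a n (signature cgamma bgamma s t) =
  (lform gamma a t - lform gamma a s) ^+ n / n`!%:R.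
Proof.
move=> s0; elim: n t => [|n IHn] t st t1; first by rewrite /= expr0 divr1.
rewrite wordA_rcons signature_rcons_sum//.
pose X := lform gamma a s.
rewrite (@eq_form_integral _ _ _ _ _ _ _ _ _
  (fun u => (fun x : R => (x - X) ^+ n / n`!%:R) (lform gamma a u))); last first.
  by move=> u /andP[su ut]; rewrite IHn// ?ltW// (lt_le_trans ut).
have := @form_integral_chain _ _ _ cgamma bgamma a
  (fun x => (x - X) ^+ n.+1 / n.+1`!%:R) (fun x => (x - X) ^+ n / n`!%:R) s t s0 st t1
  (fun x => is_derive_divided_power X x n).
move=> ->; first by rewrite -/X subrr expr0n mul0r subr0.
- move=> x; apply: cvgM; last exact: cvg_cst.
  apply: (@cvg_comp _ _ _ (fun y => y - X) (fun y => y ^+ n)).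
    by apply: cvgB; [exact: cvg_id|exact: cvg_cst].
  exact: exprn_continuous.
Qed.

Lemma wordB_signature a b s t n : 0 <= s -> s <= t -> t <= 1 ->
  wordB a b n.+1 (signature cgamma bgamma s t) =
  form_integral cgamma bgamma b s t
    (fun u => (lform gamma a u - lform gamma a s) ^+ n / n`!%:R).
Proof.
move=> s0 st t1; rewrite wordB_rcons signature_rcons_sum//.
apply: eq_form_integral => u /andP[su ut].
by rewrite wordA_signature// ltW// (lt_le_trans ut).
Qed.

End signature_word_sums.

(** * Logarithm of triangular images, by truncated power series *)

Section truncated_logarithm.
Context {R : realType}.
Variables (x : R) (M : nat).

Let E : {poly R} := \poly_(k < M.+1) (x ^+ k / k`!%:R).
Let p : {poly R} := E - 1.

Let E0 : E`_0 = 1. Proof. by rewrite coef_poly/= expr0 divr1. Qed.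

Let p0 : p`_0 = 0. Proof. by rewrite coefB coef1 E0 subrr. Qed.

(** Truncation spoils E' = x E only in degree [M]. *)
Let derivE : E^`() = x *: E - (x ^+ M.+1 / M`!%:R) *: 'X^M.
Proof.
apply/polyP => k; rewrite coef_deriv coefB !coefZ coefXn !coef_poly ltnS.
have [kM|Mk|->] := ltngtP k M.
- rewrite ltnS (ltnW kM) mulr0 subr0 factS natrM exprS.
  have k0 : k`!%:R != 0 :> R by rewrite pnatr_eq0 -lt0n fact_gt0.
  by rewrite -mulr_natr; field; rewrite k0 addrC natr1 pnatr_eq0.
- by rewrite ltnS leqNgt Mk/= mulr0 mulr0 subrr mul0rn.
- by rewrite leqnn mulr1 mul0rn mulrA -exprS subrr.
Qed.

Let dvdXp n : 'X^n %| p ^+ n.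
Proof.
rewrite dvdp_exp2r// -['X]subr0 -polyC0 dvdp_XsubCl.
by rewrite /root horner_coef0 p0.
Qed.

(* The logarithm of the truncated exponential series is [x 'X] up to degree [M],
   because its derivative [l] satisfies [E * l = E' = x E] modulo ['X^M]. *)
Lemma coef_log_exp n : (n <= M)%N ->
  (\sum_(i < M) ((-1) ^+ i / i.+1%:R) *: p ^+ i.+1)`_n = x *+ (n == 1)%N.
Proof.
set l := \sum_(i < M) _ => nM.
have dl : l^`() = (\sum_(i < M) (- p) ^+ i) * E^`().
  rewrite /l linear_sum mulr_suml; apply: eq_bigr => i _ /=.
  rewrite derivZ deriv_exp /= derivB derivC subr0 -[(_ * _) *+ _]scaler_nat scalerA.
  rewrite divfK ?pnatr_eq0// (exprNn p) -mul_polyC polyC_exp polyCN.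
  by rewrite -mulrA [_ * p ^+ i]mulrC.
have dvd : 'X^M %| E * (l^`() - x%:P).
  (* As [E] = 1 + [p], the product of [E] with the sum of the powers of [- p] telescopes to 1 - (-
     p)^M, and ['X^M] divides p^M. *)
  have -> : E * (l^`() - x%:P) = - ((x ^+ M.+1 / M`!%:R) *: 'X^M) -
      (- p) ^+ M * E^`().
    have e : (- p) ^+ M = 1 - E * \sum_(i < M) (- p) ^+ i.
      by rewrite -[LHS](subrK 1) subrX1 -[E](subrK 1) -/p -opprD mulNr addrC.
    have -> : x%:P = x *: 1 by rewrite -mul_polyC mulr1.
    rewrite e dl mulrBr mulrA -scalerAr mulr1 mulrBl mul1r.
    move: (\sum_(i < M) _) => S; move: (E * S * _) => A.
    rewrite -[x *: E](subrK ((x ^+ M.+1 / M`!%:R) *: 'X^M)) -derivE.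
    by rewrite opprD opprB addrA [RHS]addrC.
  apply: dvdp_add; rewrite dvdpNr.
    by rewrite -mul_polyC dvdp_mull.
  by rewrite (exprNn p) mulrAC dvdp_mull.
case: n nM => [|n nM].
  rewrite /l coef_sum big1// => i _.
  by rewrite coefZ exprS coef0M p0 mul0r mulr0.
(* [E] has constant term 1, so it is coprime to ['X^M] and can be cancelled. *)
have : coprimep 'X^M E.
  apply: coprimep_expl; rewrite coprimep_sym -['X]subr0 -polyC0 coprimep_XsubC.
  by rewrite /root horner_coef0 E0 oner_eq0.
move=> /(@Gauss_dvdpr _ (l^`() - x%:P)); rewrite dvd => /esym/dvdpP[q qE].
have : (l^`() - x%:P)`_n = 0 by rewrite qE coefMXn nM.
rewrite coefB coef_deriv coefC => /eqP; rewrite subr_eq0 => /eqP.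
case: n nM => [|n] nM; first by rewrite mulr1n.
by move=> /eqP; rewrite mulrn_eq0/= => /eqP.
Qed.

End truncated_logarithm.

Arguments wordB : simpl never.

Section log_word_sums.
Context {R : realType} {d : nat}.
Variables a b : 'I_d -> R.
Implicit Types xi eta : tseries R d.

Lemma eq_wordB_size n xi eta : (forall w, size w = n -> xi w = eta w) ->
  wordB a b n xi = wordB a b n eta.
Proof.
elim: n xi eta => [//|[|n] IHn] xi eta e.
  by apply: eq_bigr => i _; rewrite e.
rewrite !wordB_SS; apply: eq_bigr => i _; congr (_ * _); apply: IHn => w wn.
by apply: e; rewrite /= wn.
Qed.

Lemma wordA_tone n : wordA a n tone = (n == 0%N)%:R :> R.
Proof.
case: n => [//|n] /=; rewrite big1// => i _.
by rewrite (@eq_wordA _ _ _ _ _ (fun w => 0 * tone w)) ?wordAZ ?mul0r ?mulr0// => w;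
  rewrite mul0r.
Qed.

Section tpow_coef.
Variables (xi : tseries R d) (M : nat).
Hypothesis xi0 : xi [::] = 0.
Let p : {poly R} := \poly_(k < M.+1) wordA a k xi.
Let q : {poly R} := \poly_(k < M.+1) wordB a b k xi.

(** As [xi] vanishes on the empty word, its image is [[p, q], [0, 0]], with powers
    [[p^(m+1), p^m q], [0, 0]]. *)
Lemma wordB_tpow m k : (k <= M)%N ->
  wordB a b k (tpow xi m.+1) = (p ^+ m * q)`_k.
Proof.
elim: m k => [|m IHm] k kM.
  rewrite [tpow _ _]/= expr0 mul1r coef_poly ltnS kM.
  apply: eq_wordB_size => w _; rewrite /tmul big_ord_recr/= take_size drop_size.
  rewrite mulr1 big1 ?add0r// => i _; rewrite /tone -size_eq0 size_drop subn_eq0.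
  by rewrite leqNgt ltn_ord mulr0.
have t0 : tpow xi m.+1 [::] = 0.
  by rewrite /tpow iterS /tmul big_ord1 /= xi0 mul0r.
rewrite [tpow xi m.+2]iterS -/(tpow xi m.+1) wordB_tmul t0 mulr0 addr0.
rewrite exprS -mulrA coefM.
apply: eq_bigr => i _.
rewrite IHm ?(leq_trans (leq_subr _ _))// coef_poly ltnS.
by rewrite (leq_trans _ kM) // -ltnS.
Qed.

End tpow_coef.

(* In matrix form, [exp [[x z, B (tlog xi)], [0, 0]] = [[exp (x z), B xi], [0, 1]]]. *)
Lemma wordB_tlog xi (x : R) n : xi [::] = 1 ->
  (forall k, wordA a k xi = x ^+ k / k`!%:R) ->
  x * wordB a b n.+1 xi =
  \sum_(k < n.+1) x ^+ k.+1 / k.+1`!%:R * wordB a b (n - k).+1 (tlog xi).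
Proof.
(* The coefficients of degree n + 2 are compared in the end, so truncation above this degree is
   harmless. *)
move=> xi1 xiA; pose M := n.+2; pose eta u := xi u - tone u.
have eta0 : eta [::] = 0 by rewrite /eta xi1 subrr.
pose p : {poly R} := \poly_(k < M.+1) wordA a k eta.
pose q : {poly R} := \poly_(k < M.+1) wordB a b k eta.
have etaA k : wordA a k eta = x ^+ k / k`!%:R - (k == 0%N)%:R.
  rewrite (@eq_wordA _ _ _ _ _ (fun w => xi w + (-1) * tone w)) => [|w].
    by rewrite wordAD wordAZ wordA_tone xiA mulN1r.
  by rewrite mulN1r.
have etaB k : wordB a b k.+1 eta = wordB a b k.+1 xi.
  apply: eq_wordB_size => -[//|i w] _; exact: subr0.
have pE : p = \poly_(k < M.+1) (x ^+ k / k`!%:R) - 1.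
  apply/polyP => k; rewrite coefB coef1 !coef_poly etaA.
  by case: ltnP => // /ltn_geF; case: k => [//|k] _; rewrite subr0.
pose c i : R := (-1) ^+ i / i.+1%:R.
pose l := \sum_(i < M) c i *: p ^+ i.+1.
pose r := \sum_(i < M) c i *: p ^+ i * q.
have rE k : (k <= M)%N -> wordB a b k (tlog xi) = r`_k.
  move=> kM; rewrite coef_sum.
  under [RHS]eq_bigr => i _ do rewrite -scalerAl coefZ -(@wordB_tpow eta M eta0 i k kM).
  rewrite -wordB_sum; apply: eq_wordB_size => w wk.
  (* The terms of the logarithm beyond the length of [w] vanish, so the sum may run to [M] for all
     words of length at most [M]. *)
  pose F i := c i * tpow eta i.+1 w.
  rewrite /tlog wk big_add1 -(big_mkord xpredT F) (@big_cat_nat _ _ _ k 0%N M)//=.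
  rewrite [X in _ + X]big_nat_cond [X in _ + X]big1 ?addr0// => i /andP[/andP[ki _] _].
  by rewrite /F tpow_subr1_eq0 ?mulr0// wk ltnS.
have lrE : l * q = p * r.
  rewrite mulr_suml mulr_sumr; apply: eq_bigr => i _.
  by rewrite -!scalerAl -scalerAr mulrA -exprS.
have := congr1 (fun s : {poly R} => s`_n.+2) lrE.
have lE k : (k <= M)%N -> l`_k = x *+ (k == 1)%N.
  by move=> kM; rewrite -(coef_log_exp x kM) /l pE.
(* On the left [l] is [x 'X] up to degree [M], which leaves x times the coefficient of degree n + 1
   of [q]; on the right [p] and [r] have no constant term. *)
rewrite !coefM (bigD1 (inord 1))//= [X in _ + X]big1 ?addr0 => [|i i1]; last first.
  rewrite lE; last by rewrite -ltnS.
  rewrite (_ : (i == 1 :> nat) = false) ?mulr0n ?mul0r//.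
  by apply/negbTE; apply: contra i1 => /eqP i1; apply/eqP/val_inj; rewrite /= inordK.
rewrite inordK// lE// mulr1n subSS subn0 coef_poly ltnS leqnSn etaB => ->.
have p0 : p`_0 = 0 by rewrite coef_poly etaA expr0 divr1 subrr.
rewrite big_ord_recl /= p0 mul0r add0r.
rewrite big_ord_recr /= /bump /= add1n subnn -rE// mulr0 addr0.
apply: eq_bigr => k _; rewrite /bump add1n subSS coef_poly etaA subr0.
have kn : (k <= n)%N by rewrite -ltnS.
rewrite !ltnS (leq_trans kn)//.
by rewrite subSn// rE// /M ltnS (leq_trans (leq_subr _ _)).
Qed.

End log_word_sums.

(** * Entire logarithmic signatures *)

Section projective_norm.
Context {R : realType} {d : nat}.
Implicit Types (a b : 'I_d -> R) (xi : tseries R d) (v : 'rV[R]_d).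

(** Extension by zero to words of other lengths, so that word sums apply to a single homogeneous
    tensor. *)
Definition tensor_series n (x : tensor (R := R) (d := d) n) : tseries R d :=
  fun w => if insub w is Some t then x t else 0.

Lemma tensor_seriesE n (x : tensor n) (t : n.-tuple 'I_d) :
  tensor_series x t = x t.
Proof. by rewrite /tensor_series valK. Qed.

Lemma size_tensor_series n (x : tensor n) (f : seq 'I_d -> R) :
  (forall t : n.-tuple 'I_d, x t = f t) ->
  forall w, size w = n -> tensor_series x w = f w.
Proof.
move=> xf w /eqP wn; rewrite -[w]/(tval (Tuple wn)) tensor_seriesE; exact: xf.
Qed.

Lemma le_sum_enorm a v : `|\sum_i a i * v ord0 i| <= l1norm a * enorm v.
Proof.
rewrite (le_trans (ler_norm_sum _ _ _))// mulr_suml; apply: ler_sum => i _.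
by rewrite normrM ler_wpM2l// coord_le_enorm.
Qed.

Lemma elem_tensor_cons n (v : 'I_n.+1 -> 'rV[R]_d) i w : size w = n ->
  tensor_series (elem_tensor v) (i :: w) =
  v ord0 ord0 i * tensor_series (elem_tensor (fun k => v (lift ord0 k))) w.
Proof.
move=> /eqP wn; pose t := Tuple wn.
rewrite -[i :: w]/(tval [tuple of i :: t]) -[w]/(tval t) !tensor_seriesE !ffunE.
rewrite big_ord_recl; congr (_ * _).
by apply: eq_bigr => k _; rewrite tnthS.
Qed.

(** On an elementary tensor the word sum factors into a.v_k for all but the last vector and b.v_k
    for the last; each factor is at most [K] times the Euclidean norm. *)
Lemma wordB_elem_tensor a b (K : R) n (v : 'I_n.+1 -> 'rV[R]_d) :
  l1norm a <= K -> l1norm b <= K ->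
  `|wordB a b n.+1 (tensor_series (elem_tensor v))| <=
  K ^+ n.+1 * \prod_(k < n.+1) enorm (v k).
Proof.
move=> aK bK; elim: n v => [|n IHn] v.
  rewrite big_ord1 expr1 wordB_1.
  under eq_bigr => i _.
    rewrite elem_tensor_cons// (@size_tensor_series _ _ (fun=> 1)) ?mulr1//; last first.
      by move=> t; rewrite ffunE big_ord0.
    over.
  by apply: (le_trans (le_sum_enorm _ _)); rewrite ler_wpM2r// sqrtr_ge0.
rewrite wordB_SS (_ : \sum_i _ = (\sum_i a i * v ord0 ord0 i) *
    wordB a b n.+1 (tensor_series (elem_tensor (fun k => v (lift ord0 k))))).
  rewrite normrM exprS big_ord_recl mulrACA ler_pM//.
  by apply: (le_trans (le_sum_enorm _ _)); rewrite ler_wpM2r// sqrtr_ge0.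
rewrite mulr_suml; apply: eq_bigr => i _; rewrite -mulrA; congr (_ * _); rewrite -wordBZ.
by apply: eq_wordB_size => w wn; exact: elem_tensor_cons.
Qed.

(** Expansion in the tensor basis, the coefficient being absorbed in the first factor. It shows that
    the infimum in [proj_norm] is over a non-empty set. *)
Lemma tensor_sum_elem n (x : tensor n.+1) :
  exists m (v : 'I_m -> 'I_n.+1 -> 'rV[R]_d), x = \sum_(j < m) elem_tensor (v j).
Proof.
exists #|{: n.+1.-tuple 'I_d}|, (fun j k =>
  (if k == ord0 then x (enum_val j) else 1) *:
  delta_mx ord0 (tnth (enum_val j) k)).
apply/ffunP => w; rewrite sum_ffunE.
under eq_bigr do rewrite ffunE.
rewrite -(big_enum_val (A := predT) (fun t : n.+1.-tuple 'I_d => \prod_(k < n.+1)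
  ((if k == ord0 then x t else 1) *: delta_mx ord0 (tnth t k) : 'rV[R]_d)
    ord0 (tnth w k))).
rewrite (bigD1 w)//= big_ord_recl big1 => [|k _]; last first.
  by rewrite !mxE !eqxx /= mulr1.
rewrite !mxE !eqxx !mulr1 big1 ?addr0// => t tw.
have /existsP[k kP] : [exists k, tnth w k != tnth t k].
  apply: contraNT tw => /existsPn wt; apply/eqP/eq_from_tnth => k.
  by apply/esym/eqP; have := wt k; rewrite negbK.
by rewrite (bigD1 k)//= !mxE eqxx /= (negPf kP) mulr0 mul0r.
Qed.

(** By linearity every decomposition into elementary tensors gives such a bound, hence so does the
    infimum. *)
Lemma wordB_le_proj_norm a b (K : R) n xi : 0 < K ->
  l1norm a <= K -> l1norm b <= K ->
  `|wordB a b n.+1 xi| <= K ^+ n.+1 * proj_norm (tcomponent xi n.+1).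
Proof.
move=> K0 aK bK; rewrite mulrC -ler_pdivrMr ?exprn_gt0//.
apply: lb_le_inf.
  have [m [v xE]] := tensor_sum_elem (tcomponent xi n.+1).
  by exists (\sum_(j < m) \prod_(k < n.+1) enorm (v j k)); exists m, v.
move=> _ [m [v [xE ->]]]; rewrite ler_pdivrMr ?exprn_gt0// mulrC.
rewrite (@eq_wordB_size _ _ _ _ _ xi
  (fun w => \sum_(j < m) 1 * tensor_series (elem_tensor (v j)) w)); last first.
  move=> w /eqP wn; rewrite -[w]/(tval (Tuple wn)).
  under eq_bigr do rewrite mul1r tensor_seriesE.
  by rewrite -sum_ffunE -xE ffunE.
rewrite wordB_sum (le_trans (ler_norm_sum _ _ _))// mulr_sumr.
by apply: ler_sum => j _; rewrite mul1r wordB_elem_tensor.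
Qed.

End projective_norm.

Section entire_series.
Context {R : realType}.

(** The series converges at some z with |z| > r, and the terms of a convergent series are
    bounded. *)
Lemma power_series_radius_pinfty (u : R^nat) (r : R) :
  power_series_radius u = +oo%E -> (forall n, 0 <= u n) -> 0 < r ->
  exists M, forall n, u n * r ^+ n <= M.
Proof.
move=> urad u0 r0.
have : (r%:E < power_series_radius u)%E by rewrite urad ltry.
move=> /ereal_sup_gt[_ [z uz <-]]; rewrite lte_fin => rz.
have /cvgP/cvg_seq_bounded[M [_ Mu]] := cvg_series_cvg_0 uz.
exists (`|M| + 1) => n.
have := Mu (`|M| + 1) (le_lt_trans (ler_norm M) (ltr_pwDr ltr01 (lexx _))) n I.
apply: le_trans; rewrite /pseries normrM normrX ger0_norm// ler_wpM2l//.
by rewrite lerXn2r ?nnegrE ?(ltW r0)// ltW.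
Qed.

End entire_series.

(** * Power series at imaginary points, in real and imaginary parts *)

Section powers_of_i.
Context {R : realType}.
Implicit Types (x y : R).

(* Real and imaginary part of the [n]-th power of the imaginary unit. *)
Definition cosign n : R := (~~ odd n)%:R * (-1) ^+ n./2.
Definition sisign n : R := (odd n)%:R * (-1) ^+ n./2.

Lemma cosignD m n : cosign (m + n) = cosign m * cosign n - sisign m * sisign n.
Proof.
rewrite /cosign /sisign oddD halfD !exprD.
by case: (odd m); case: (odd n) => /=; rewrite ?expr1 ?expr0; ring.
Qed.

Lemma norm_cosign n : `|cosign n| <= 1.
Proof.
rewrite normrM normrX normrN1 expr1n mulr1.
by case: (odd n) => /=; rewrite ?normr0 ?normr1.
Qed.

Lemma norm_sisign n : `|sisign n| <= 1.
Proof.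
rewrite normrM normrX normrN1 expr1n mulr1.
by case: (odd n) => /=; rewrite ?normr0 ?normr1.
Qed.

Lemma cos_coeff_cosign x n : cos_coeff x n = cosign n * x ^+ n / n`!%:R.
Proof. by []. Qed.

Lemma cos_coeff_sisign x n :
  cos_coeff x n.+1 = - (sisign n * x ^+ n.+1 / n.+1`!%:R).
Proof.
rewrite cos_coeff_cosign /cosign /sisign /= negbK uphalf_half exprD.
by case: (odd n) => /=; rewrite ?expr1 ?expr0; ring.
Qed.

(** Termwise domination by the exponential series; the bound depends on [M] only, so it is uniform
    in [x]. *)
Lemma cos_tail x M N : `|x| <= M ->
  `|cos x - series (cos_coeff x) N| <= expR M - series (exp_coeff M) N.
Proof.
move=> xM; have M0 := le_trans (normr_ge0 x) xM.
have cc : `|series (cos_coeff x) n - series (cos_coeff x) N| @[n --> \oo] -->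
    `|cos x - series (cos_coeff x) N|.
  apply: cvg_norm; apply: cvgB; last exact: cvg_cst.
  rewrite cos.unlock; exact: is_cvg_series_cos_coeff.
have ce : series (exp_coeff M) n - series (exp_coeff M) N @[n --> \oo] -->
    expR M - series (exp_coeff M) N.
  apply: cvgB; last exact: cvg_cst.
  exact: is_cvg_series_exp_coeff.
apply: (ler_cvg_to cc ce); near=> n.
have Nn : (N <= n)%N by near: n; exact: nbhs_infty_ge.
rewrite !sub_series_geq// (le_trans (ler_norm_sum _ _ _))//.
apply: ler_sum => k _; rewrite cos_coeff_cosign normrM normfV normr_nat.
rewrite ler_wpM2r ?invr_ge0//.
rewrite normrM -[leRHS]mul1r ler_pM// ?norm_cosign// normrX.
by rewrite lerXn2r ?nnegrE.
Unshelve. all: by end_near. Qed.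

(** The sum of i^k (2 pi)^(k+1) / (k+1)! is (exp (2 i pi) - 1) / i = 0. Its real part is sin (2 pi);
    its imaginary part, treated next, is 1 - cos (2 pi). *)
Lemma cvg_cosign_2pi :
  (\sum_(k < n) cosign k * (pi *+ 2 : R) ^+ k.+1 / k.+1`!%:R) @[n --> \oo] --> (0 : R).
Proof.
have -> : (fun n => \sum_(k < n) cosign k * (pi *+ 2 : R) ^+ k.+1 / k.+1`!%:R) =
    (fun n => series (sin_coeff (pi *+ 2 : R)) (n + 1)%N).
  apply/funext => n; rewrite addn1 /series /= big_nat_recl//.
  by rewrite big_mkord [X in X + _]/sin_coeff/= !mul0r add0r.
rewrite (@cvg_shiftn 1 _ (series (sin_coeff (pi *+ 2)))).
have : series (sin_coeff (pi *+ 2)) n @[n --> \oo] --> sin (pi *+ 2 : R).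
  by rewrite sin.unlock; exact: is_cvg_series_sin_coeff.
by rewrite sin2pi.
Qed.

Lemma cvg_sisign_2pi :
  (\sum_(k < n) sisign k * (pi *+ 2 : R) ^+ k.+1 / k.+1`!%:R) @[n --> \oo] --> (0 : R).
Proof.
have -> : (fun n => \sum_(k < n) sisign k * (pi *+ 2 : R) ^+ k.+1 / k.+1`!%:R) =
    (fun n => 1 - series (cos_coeff (pi *+ 2 : R)) (n + 1)%N).
  apply/funext => n; rewrite addn1 [series _ _]big_nat_recl// big_mkord.
  have -> : cos_coeff (pi *+ 2) 0 = 1 :> R.
    by rewrite cos_coeff_cosign /cosign /= !expr0 fact0 divr1 !mulr1.
  rewrite opprD addrA subrr add0r -sumrN; apply: eq_bigr => k _.
  by rewrite cos_coeff_sisign opprK.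
have cc : series (cos_coeff (pi *+ 2)) (n + 1)%N @[n --> \oo] --> (1 : R).
  rewrite (@cvg_shiftn 1 _ (series (cos_coeff (pi *+ 2)))) -cos2pi cos.unlock.
  exact: is_cvg_series_cos_coeff.
by have := cvgB (cvg_cst (1 : R)) cc; rewrite subrr; exact.
Qed.

End powers_of_i.

Section cauchy_product.
Context {R : realType}.

Lemma triangular_sum (F : nat -> nat -> R) N :
  \sum_(n < N) \sum_(k < n.+1) F (n - k)%N k = \sum_(m < N) \sum_(k < N - m) F m k.
Proof.
elim: N => [|N IHN]; first by rewrite !big_ord0.
rewrite big_ord_recr/= IHN [RHS]big_ord_recr /= subSnn big_ord1.
rewrite [X in _ + X = _](reindex_inj rev_ord_inj)/= [X in _ + X = _]big_ord_recr/=.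
rewrite subSS subnn subn0 addrA.
congr (_ + _); rewrite -big_split/=; apply: eq_bigr => m _.
have mN : (m <= N)%N by rewrite ltnW.
by rewrite subSS subKn// subSn// big_ord_recr.
Qed.

(** The convolution obeys [T n.+1 = e n.+1 + 2^-1 * T n], a contraction with vanishing
    perturbation. *)
Lemma geometric_convolution_cvg0 (e : R^nat) : (forall n, 0 <= e n) ->
  e n @[n --> \oo] --> 0 ->
  (\sum_(m < n) 2^-1 ^+ m * e (n - m)%N) @[n --> \oo] --> 0.
Proof.
move=> e0 ecvg; set T := fun n => \sum_(m < n) _.
have TS n : T n.+1 = e n.+1 + 2^-1 * T n.
  rewrite /T big_ord_recl expr0 mul1r subn0 mulr_sumr; congr (_ + _).
  by apply: eq_bigr => i _; rewrite /bump /= ?add1n subSS exprS mulrA.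
have T0 n : 0 <= T n by apply: sumr_ge0 => i _; rewrite mulr_ge0// exprn_ge0.
apply/cvgr0Pnorm_le => d d0.
(* [d / 2] is the fixed point of the map taking t to t / 2 + d / 4. *)
have d4 : 0 < d / 4 by rewrite divr_gt0.
have /cvgr0Pnorm_le/(_ _ d4)[N _ eN] := ecvg.
have TN k : T (k + N)%N <= 2^-1 ^+ k * T N + d / 2.
  elim: k => [|k IHk]; first by rewrite expr0 mul1r lerDl divr_ge0// ltW.
  rewrite addSn TS exprS.
  have : e (k + N).+1 <= d / 4.
    by rewrite (le_trans (ler_norm _))// eN//= -addSn leq_addl.
  move: IHk; set u := _ * T N; rewrite -mulrA -/u; lra.
have gcvg : T N * 2^-1 ^+ n @[n --> \oo] --> 0.
  have := cvgM (cvg_cst (T N)) (@cvg_expr R 2^-1 _).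
  by rewrite mulr0; apply; rewrite ger0_norm ?invr_ge0// invf_lt1// ltr1n.
have /cvgr0Pnorm_le/(_ _ (divr_gt0 d0 (ltr0Sn _ 1)))[K _ gK] := gcvg.
exists (K + N)%N => // n /= Kn; rewrite ger0_norm//.
have Nn : (N <= n)%N by rewrite (leq_trans _ Kn)// leq_addl.
have /gK : (K <= n - N)%N by rewrite leq_subRL// addnC.
rewrite /= -{2}(subnK Nn) => /(le_trans (ler_norm _)); rewrite mulrC.
by have := TN (n - N)%N; lra.
Qed.

(* The second hypothesis is [s(z) = ((exp (x z) - 1) / (x z)) b(z)] as formal
   power series, and [exp (x z) = 1] at [z = i * theta]; the conclusion is the
   real part of [s(i * theta) = 0]. *)
Lemma cvg_cauchy_product_2pi (s b : R^nat) (x theta C : R) :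
  theta * x = pi *+ 2 ->
  (forall n, x * s n = \sum_(k < n.+1) x ^+ k.+1 / k.+1`!%:R * b (n - k)%N) ->
  (forall n, `|b n| * `|theta| ^+ n <= C * 2^-1 ^+ n) ->
  (\sum_(k < n) cosign k * theta ^+ k * s k) @[n --> \oo] --> (0 : R).
Proof.
move=> tx sE bC.
pose P (c : nat -> R) n := \sum_(k < n) c k * (pi *+ 2 : R) ^+ k.+1 / k.+1`!%:R.
pose e n : R := `|P cosign n| + `|P sisign n|.
have ecvg : e n @[n --> \oo] --> 0.
  have := cvgD (cvg_norm (@cvg_cosign_2pi R)) (cvg_norm (@cvg_sisign_2pi R)).
  by rewrite normr0 addr0; exact.
(* The factor 2 pi = theta x turns each [s k] into [x * s k], to which the product formula applies;
   summing over the index of [b] last collects the partial sums [P]. *)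
have key n : (pi *+ 2) * \sum_(k < n) cosign k * theta ^+ k * s k =
    \sum_(m < n) b m * theta ^+ m *
      (cosign m * P cosign (n - m)%N - sisign m * P sisign (n - m)%N).
  pose F m k := b m * theta ^+ m * (cosign m *
    (cosign k * (pi *+ 2) ^+ k.+1 / k.+1`!%:R) - sisign m *
    (sisign k * (pi *+ 2) ^+ k.+1 / k.+1`!%:R)).
  transitivity (\sum_(m < n) \sum_(k < n - m) F m k); last first.
    apply: eq_bigr => m _; rewrite -mulr_sumr; congr (_ * _).
    by rewrite sumrB /P !mulr_sumr.
  rewrite -triangular_sum mulr_sumr; apply: eq_bigr => m _.
  rewrite -tx (_ : _ * _ = cosign m * theta ^+ m.+1 * (x * s m)); last first.
    by rewrite exprS; ring.
  rewrite sE mulr_sumr; apply: eq_bigr => k _.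
  have km : (k <= m)%N by rewrite -ltnS.
  rewrite /F -tx exprMn -[in cosign m](subnK km) cosignD.
  rewrite -[in theta ^+ m.+1](subnK km) -addnS exprD.
  ring.
have Tcvg := geometric_convolution_cvg0 (fun n => addr_ge0 (normr_ge0 _) (normr_ge0 _)) ecvg.
have Ccvg : C / (pi *+ 2) * (\sum_(m < n) 2^-1 ^+ m * e (n - m)%N) @[n --> \oo] -->
    (0 : R).
  by have := cvgM (cvg_cst (C / (pi *+ 2))) Tcvg; rewrite mulr0; exact.
apply/norm_cvg0P; apply: (squeeze_cvgr _ _ Ccvg); last exact: cvg_cst.
near=> n; rewrite normr_ge0 /=.
have pi2 : 0 < pi *+ 2 :> R by rewrite pmulrn_lgt0// pi_gt0.
rewrite mulrAC ler_pdivlMr// mulrC -{1}(gtr0_norm pi2) -normrM key.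
rewrite (le_trans (ler_norm_sum _ _ _))// mulr_sumr; apply: ler_sum => m _.
rewrite mulrA normrM ler_pM// ?normrM ?normrX//.
apply: (le_trans (ler_normB _ _)); rewrite [`|cosign m * _|]normrM [`|sisign m * _|]normrM.
by apply: lerD; rewrite ler_piMl// ?norm_cosign ?norm_sisign.
Unshelve. all: by end_near. Qed.

End cauchy_product.

(** * The vanishing cosine integral *)

Section cosine_integral.
Context {R : realType} {d : nat}.
Variable gamma : R -> 'rV[R]_d.
Hypothesis cgamma : {within `[0, 1], continuous gamma}.
Hypothesis bgamma : path_bounded_variation 0 1 gamma.
Variables (a b : 'I_d -> R) (s t : R).
Hypotheses (s0 : 0 <= s) (st : s <= t) (t1 : t <= 1).
Local Notation x := (lform gamma a).
Local Notation L := (tlog (signature cgamma bgamma s t)).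
Local Notation "\int h" := (form_integral cgamma bgamma b s t h)
  (at level 36, h at level 36).

Lemma wordB_tlog_geometric (theta : R) : tradius L = +oo%E ->
  exists C, forall n, `|wordB a b n.+1 L| * `|theta| ^+ n <= C * 2^-1 ^+ n.
Proof.
move=> Lrad; pose K := l1norm a + l1norm b + 1.
have a0 := l1norm_ge0 a; have b0 := l1norm_ge0 b.
have K0 : 0 < K by rewrite ltr_wpDl// addr_ge0.
have u0 n : 0 <= proj_norm (tcomponent L n).
  case: n => [|n]; first exact: normr_ge0.
  (* Applied to the zero form, the bound on word sums yields that the projective norm is
     non-negative. *)
  have c0 : l1norm (fun _ : 'I_d => 0 : R) <= 1.
    by rewrite /l1norm big1 ?ler01// => i _; rewrite normr0.
  have := wordB_le_proj_norm n L ltr01 c0 c0.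
  by rewrite expr1n mul1r; apply: le_trans.
(* [K] absorbs the growth of the word sums, |theta| + 1 the powers of theta and the shift of degree,
   and the factor 2 leaves the geometric decay. *)
have r0 : 0 < 2 * (K * (`|theta| + 1)) by rewrite !mulr_gt0// ltr_wpDl.
have [M uM] := power_series_radius_pinfty Lrad u0 r0.
exists (M / 2) => n.
have th : `|theta| ^+ n <= (`|theta| + 1) ^+ n.+1.
  rewrite exprS -[leLHS]mul1r ler_pM ?exprn_ge0//; first by rewrite lerDr.
  by rewrite lerXn2r ?nnegrE ?addr_ge0// lerDl.
have aK : l1norm a <= K by rewrite /K; lra.
have bK : l1norm b <= K by rewrite /K; lra.
have := ler_pM (normr_ge0 _) (exprn_ge0 n (normr_ge0 theta))
  (wordB_le_proj_norm n L K0 aK bK) th.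
move=> /le_trans; apply.
have -> : M / 2 * 2^-1 ^+ n = M * 2^-1 ^+ n.+1 by rewrite exprS mulrA.
rewrite exprVn ler_pdivlMr ?exprn_gt0//; apply: le_trans (uM n.+1).
by rewrite !exprMn le_eqVlt; apply/orP; left; apply/eqP; ring.
Qed.

(** The partial sums of the cosine series converge uniformly on the path, and their integrals tend
    to 0 as the real part of the product identity at z = i theta. *)
Lemma form_integral_cos_eq0 : tradius L = +oo%E -> x t != x s ->
  \int (fun u => cos (pi *+ 2 / (x t - x s) * (x u - x s))) = 0.
Proof.
move=> Lrad xts; set theta := pi *+ 2 / (x t - x s).
have X0 : x t - x s != 0 by rewrite subr_eq0.
have tX : theta * (x t - x s) = pi *+ 2 by rewrite divfK.
(* The coefficient of z^n in the integral of exp (z (x_u - x_s)) against dy_u. *)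
pose sigma n := \int (fun u => (x u - x s) ^+ n / n`!%:R).
have [C bC] := wordB_tlog_geometric theta Lrad.
have scvg : (\sum_(k < n) cosign k * theta ^+ k * sigma k) @[n --> \oo] --> (0 : R).
  apply: (cvg_cauchy_product_2pi tX _ bC) => n.
  rewrite /sigma -wordB_signature// (@wordB_tlog _ _ a b _ (x t - x s))//.
  by move=> k; rewrite wordA_signature.
have cx : {within `[s, t], continuous (fun u => x u - x s)}.
  apply: within_continuousB; last exact: within_continuous_cst.
  exact: within_continuousW (@lform_continuous _ _ _ cgamma a).
have ccos : {within `[s, t], continuous (fun u => cos (theta * (x u - x s)))}.
  apply: (@within_continuous_comp _ _ cos); first exact: continuous_cos.
  exact: within_continuousZ.
have cpow n : {within `[s, t], continuous (fun u => (x u - x s) ^+ n / n`!%:R)}.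
  have -> : (fun u => (x u - x s) ^+ n / n`!%:R) =
      (fun u => n`!%:R^-1 * (x u - x s) ^+ n) by apply/funext => u; rewrite mulrC.
  apply: within_continuousZ.
  exact: (@within_continuous_comp _ _ (fun y => y ^+ n) _ (@exprn_continuous R n)).
have sumE n : \sum_(k < n) cosign k * theta ^+ k * sigma k =
    \int (fun u => series (cos_coeff (theta * (x u - x s))) n).
  under eq_bigr do rewrite -form_integralZ//.
  rewrite -form_integral_sum//; last by move=> k; exact: within_continuousZ.
  apply: eq_form_integral => u _; rewrite /series/= big_mkord.
  by apply: eq_bigr => k _; rewrite cos_coeff_cosign [(theta * _) ^+ _]exprMn !mulrA.
have cser n : {within `[s, t], continuous
    (fun u => series (cos_coeff (theta * (x u - x s))) n)}.
  have -> : (fun u => series (cos_coeff (theta * (x u - x s))) n) =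
      (fun u => \sum_(k < n) cosign k * theta ^+ k * ((x u - x s) ^+ k / k`!%:R)).
    apply/funext => u; rewrite /series/= big_mkord.
    by apply: eq_bigr => k _; rewrite cos_coeff_cosign [(theta * _) ^+ _]exprMn !mulrA.
  by apply: within_continuous_sum => k; exact: within_continuousZ.
pose M := `|theta| * (l1norm a * (pvar gamma t - pvar gamma s)).
pose D := l1norm b * (pvar gamma t - pvar gamma s).
have V0 : 0 <= pvar gamma t - pvar gamma s by rewrite subr_ge0 pvar_le.
have xM u : s < u < t -> `|theta * (x u - x s)| <= M.
  move=> /andP[su ut]; rewrite normrM ler_wpM2l//.
  have u1 := le_trans (ltW ut) t1.
  apply: (le_trans (le_lformB_pvar bgamma a s0 (ltW su) u1)).
  by rewrite ler_wpM2l ?l1norm_ge0// lerD2r pvar_le// ?(ltW ut)// (le_trans s0 (ltW su)).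
have tail_cvg : expR M - series (exp_coeff M) n @[n --> \oo] --> 0.
  rewrite -(subrr (expR M)); apply: cvgB; first exact: cvg_cst.
  exact: is_cvg_series_exp_coeff.
have tail_ge0 n : 0 <= expR M - series (exp_coeff M) n.
  have : `|(0 : R)| <= M by rewrite normr0 !mulr_ge0// l1norm_ge0.
  by move=> /(@cos_tail _ _ _ n); apply: le_trans.
apply/eqP; rewrite -normr_le0.
have lim0 : `|\sum_(k < n) cosign k * theta ^+ k * sigma k| +
    D * (expR M - series (exp_coeff M) n) @[n --> \oo] --> 0.
  have := cvgD (cvg_norm scvg) (cvgM (cvg_cst D) tail_cvg).
  by rewrite normr0 mulr0 addr0; exact.
apply: (ler_cvg_to (@cvg_cst _ _ _ _ _) lim0); near=> n.
rewrite -[in leLHS](subrK (\sum_(k < n) cosign k * theta ^+ k * sigma k) (\int _)).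
rewrite addrC (le_trans (ler_normD _ _))// lerD2l sumE -form_integralB//.
rewrite /D mulrAC le_form_integral//; first exact: within_continuousB.
by move=> u /xM; exact: cos_tail.
Unshelve. all: by end_near. Qed.

End cosine_integral.

(** * First-order relations between coordinates *)

Section trigonometric_increments.
Context {R : realType}.
Implicit Types (x y z e : R).

Lemma sin_lipschitz x y : `|sin y - sin x| <= `|y - x|.
Proof.
have [z _ ->] := MVT_between x y (@is_derive_sin R).
by rewrite normrM ler_piMl// cos_max.
Qed.

Lemma cos_lipschitz x y : `|cos y - cos x| <= `|y - x|.
Proof.
have [z _ ->] := MVT_between x y (@is_derive_cos R).
by rewrite normrM ler_piMl// normrN sin_max.
Qed.

(** The slope is taken at a point [z] near both [x] and [y], so that one fixed frequency serves for
    all nearby pairs. *)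
Lemma cos_increment x y z e : `|z - x| <= e -> `|z - y| <= e ->
  `|cos y - cos x + (y - x) * sin z| <= `|y - x| * e.
Proof.
move=> zx zy; have [w zw ->] := MVT_between x y (@is_derive_cos R).
have -> : - sin w * (y - x) + (y - x) * sin z = (y - x) * (sin z - sin w) by ring.
rewrite normrM ler_wpM2l//.
apply: (le_trans (sin_lipschitz _ _)); apply: (le_trans (zw z)).
by rewrite ge_max zx.
Qed.

End trigonometric_increments.

Section total_variation_bound.
Context {R : realType}.

Lemma dominated_total_variation (f W : R -> R) (a b : R) : a <= b ->
  (forall u v, a <= u -> u <= v -> v <= b -> `|f v - f u| <= W v - W u) ->
  (total_variation a b f <= (W b - W a)%:E)%E.
Proof.
move=> ab fW; apply: ge_ereal_sup => _ [_ [s abs <-] <-]; rewrite lee_fin.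
elim: s a ab abs fW => [|x s IHs] a ab abs fW.
  by rewrite variation_nil (itv_partition_nil abs) subrr.
have [/= /andP[ax xs] xsb] := abs.
have xbs : itv_partition x b s by split.
have xb := itv_partition_le xbs.
have IH : variation x b f s <= W b - W x.
  by apply: IHs => // u v xu uv vb; apply: fW => //; exact: le_trans (ltW ax) xu.
rewrite (variation_zip f abs) /= big_cons -(variation_zip f xbs) /=.
have := fW a x (lexx a) (ltW ax) xb; lra.
Qed.

End total_variation_bound.

Section first_order_relation.
Context {R : realType} {d : nat}.
Variable gamma : R -> 'rV[R]_d.
Hypothesis cgamma : {within `[0, 1], continuous gamma}.
Hypothesis bgamma : path_bounded_variation 0 1 gamma.
Hypothesis entire_log_signature : forall s t : R, 0 <= s -> s <= t -> t <= 1 ->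
  tradius (tlog (signature cgamma bgamma s t)) = +oo%E.
Implicit Types (a b : 'I_d -> R) (s t u v T : R).
Local Notation W := (pvar gamma).

Lemma near_div (c H e : R) : H != 0 -> 0 < e ->
  exists2 r, 0 < r & forall y, `|H - y| < r -> y != 0 /\ `|c / H - c / y| < e.
Proof.
move=> H0 e0.
have cV : c / y @[y --> H] --> c / H.
  by apply: cvgM; [exact: cvg_cst|apply: cvgV => //; exact: cvg_id].
have /cvgrPdist_lt/(_ e e0)/nbhs_ballP[r /= r0 Hr] := cV.
exists (Num.min r `|H|); first by rewrite lt_min r0 normr_gt0.
move=> y; rewrite lt_min => /andP[yr yH]; split; last exact: Hr.
by apply: contraTneq yH => ->; rewrite subr0 ltxx.
Qed.

(* Differentiating in [t] at [T] the vanishing integral of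
   [cos (2 pi (x_u - x_s) / (x_t - x_s)) dy_u] over [[s, t]]: the upper bound
   contributes [dy_t], and the change of frequency a multiple of [dx_t]. *)
Lemma first_order_relation a b s T : 0 <= s -> s <= T -> T <= 1 ->
  lform gamma a T != lform gamma a s ->
  exists q, forall e, 0 < e -> exists2 r, 0 < r & forall u v,
    0 <= u -> u <= v -> v <= 1 -> `|T - u| < r -> `|T - v| < r ->
    `|(lform gamma b v - lform gamma b u) -
      q * (lform gamma a v - lform gamma a u)| <= e * (W v - W u).
Proof.
set x := lform gamma a; set y := lform gamma b => s0 sT T1 xTs.
have {}sT : s < T.
  by rewrite lt_neqAle sT andbT; apply: contra_neq xTs => ->.
have [tau tauE] : exists tau : R, tau = pi *+ 2 by exists (pi *+ 2).
pose I s t h := form_integral cgamma bgamma b s t h.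
pose H := x T - x s; pose om t := tau / (x t - x s); pose w := om T.
have H0 : H != 0 by rewrite subr_eq0.
have pi2 : 1 <= tau.
  by have := pi_ge2 R; rewrite tauE mulr2n; lra.
have pi20 : 0 < tau by exact: lt_le_trans pi2.
have cx : {within `[0, 1], continuous (fun u => x u - x s)}.
  apply: within_continuousB; last exact: within_continuous_cst.
  exact: (@lform_continuous _ _ _ cgamma a).
have ccos c : {within `[0, 1], continuous (fun u => cos (c * (x u - x s)))}.
  apply: (@within_continuous_comp _ _ cos); first exact: continuous_cos.
  exact: within_continuousZ.
pose g u := (x u - x s) * sin (w * (x u - x s)).
have cg : {within `[0, 1], continuous g}.
  apply: (@within_continuous_comp _ (fun u => x u - x s) (fun z => z * sin (w * z))) => // z.
  apply: cvgM; first exact: cvg_id.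
  apply: (@cvg_comp _ _ _ (fun z => w * z) sin); last exact: continuous_sin.
  exact: mulrl_continuous.
(* The integral of cos (w (x_u - x_s)) dy_u has derivative - kappa in w, and dw = - (w^2 / tau) dx;
   its upper end contributes dy, since the cosine is 1 there. The sum vanishes, which gives this
   ratio. *)
pose kappa := I s T g; exists (- (w ^+ 2 / tau * kappa)) => e e0.
pose Wt := W 1 - W 0.
have W0 u v : 0 <= u -> u <= v -> v <= 1 -> 0 <= W v - W u <= Wt.
  move=> u0 uv v1; rewrite subr_ge0 pvar_le//= lerB// pvar_le//.
    exact: le_trans uv.
  exact: le_trans v1.
have Wt0 : 0 <= Wt by have /andP[] := W0 0 1 (lexx 0) ler01 (lexx 1).
have la := l1norm_ge0 a; have lb := l1norm_ge0 b.
pose Rb := l1norm a * Wt; have Rb0 : 0 <= Rb by rewrite mulr_ge0.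
have xRb u v : 0 <= u -> u <= v -> v <= 1 -> `|x v - x u| <= Rb.
  move=> u0 uv v1; apply: (le_trans (le_lformB_pvar bgamma a u0 uv v1)).
  by rewrite ler_wpM2l//; have /andP[] := W0 _ _ u0 uv v1.
clearbody Rb.
pose B := l1norm b * (Rb * Rb) * Wt.
have B0 : 0 <= B by rewrite !mulr_ge0.
pose P := (`|w| + 1) ^+ 2.
have P0 : 0 <= P by rewrite sqr_ge0.
(* The coefficient of [eta] times the increment of [W] in the final sum of the four errors; [eta] is
   chosen to keep it below [e]. *)
pose C := P * l1norm a * (2 * `|kappa| + 1 + B) + l1norm b.
have C0 : 0 <= C by rewrite addr_ge0// !mulr_ge0// !addr_ge0// mulr_ge0.
pose eta := Num.min 1 (e / (C + 1)).
have eta0 : 0 < eta by rewrite lt_min ltr01 divr_gt0// ltr_wpDl.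
have eta1 : eta <= 1 by rewrite ge_min lexx.
have etaC : eta * C <= e.
  apply: (@le_trans _ _ (e / (C + 1) * C)).
    by rewrite ler_wpM2r// ge_min lexx orbT.
  by rewrite mulrAC ler_pdivrMr ?ltr_wpDl// ler_wpM2l ?lerDl// ltW.
clearbody eta.
have [r1 r10 omr] := near_div tau H0 eta0.
(* The second bound keeps the phase on [[u, v]] within [eta] of tau, where the cosine is 1. *)
pose rho := Num.min r1 (eta / (2 * (`|w| + 1))).
have w1 : 0 < `|w| + 1 by rewrite ltr_wpDl.
have rho0 : 0 < rho by rewrite lt_min r10 divr_gt0// mulr_gt0.
have rho1 : rho <= r1 by rewrite ge_min lexx.
have rho2 : rho <= eta / (2 * (`|w| + 1)) by rewrite ge_min lexx orbT.
clearbody rho.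
have T01 : 0 <= T <= 1 by rewrite (le_trans s0 (ltW sT)).
have [r2 r20 xr] := (within_continuousP _ _ _).1 cx T rho T01 rho0.
have cI : {within `[s, 1], continuous (I s ^~ g)}.
  by apply: form_integral_continuous => //; exact: within_continuousW cg.
have sT1 : s <= T <= 1 by rewrite (ltW sT).
have [r3 r30 Ir] := (within_continuousP _ _ _).1 cI T eta sT1 eta0.
have {}xr t : 0 <= t <= 1 -> `|T - t| < r2 -> `|H - (x t - x s)| < rho by exact: xr.
have {}Ir t : s <= t <= 1 -> `|T - t| < r3 -> `|kappa - I s t g| < eta by exact: Ir.
exists (Num.min (T - s) (Num.min r2 r3)).
  by rewrite !lt_min subr_gt0 sT r20.
have near t : 0 <= t -> t <= 1 -> `|T - t| < Num.min (T - s) (Num.min r2 r3) ->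
    [/\ s < t, `|H - (x t - x s)| < rho & `|kappa - I s t g| < eta].
  move=> t0 t1; rewrite !lt_min => /and3P[ts t2 t3].
  have st : s < t by have := le_lt_trans (ler_norm _) ts; rewrite ltrD2l ltrN2.
  by split => //; [apply: xr => //; rewrite t0|apply: Ir => //; rewrite (ltW st)].
have near_om t : `|H - (x t - x s)| < rho -> x t != x s /\ `|w - om t| < eta.
  by move=> /lt_le_trans/(_ rho1)/omr[+ ?]; rewrite subr_eq0.
move=> u v u0 uv v1 Tu Tv; have v0 := le_trans u0 uv; have u1 := le_trans uv v1.
have [su xu kI] := near u u0 u1 Tu; have [sv xv _] := near v v0 v1 Tv.
clearbody w.
have [xus wu] := near_om _ xu; have [xvs wv] := near_om _ xv.
have cos0 t : s < t -> t <= 1 -> x t != x s ->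
    I s t (fun z => cos (om t * (x z - x s))) = 0.
  by move=> st t1 xts; rewrite /om tauE; apply: form_integral_cos_eq0 => //; [exact: ltW|
    apply: entire_log_signature => //; exact: ltW].
have sub (h : R -> R) t t' : 0 <= t -> t' <= 1 -> {within `[0, 1], continuous h} ->
  {within `[t, t'], continuous h} by exact: within_continuousW.
set Dx := x v - x u; set Dy := y v - y u; set dW := W v - W u.
have /andP[dW0 _] := W0 u v u0 uv v1; rewrite -/dW in dW0.
have DxW : `|Dx| <= l1norm a * dW by exact: le_lformB_pvar.
have wvb : `|om v| <= `|w| + 1.
  by rewrite -[om v](subKr w) (le_trans (ler_normB _ _))// lerD// (le_trans (ltW wv)).
have wub : `|om u| <= `|w| + 1.
  by rewrite -[om u](subKr w) (le_trans (ler_normB _ _))// lerD// (le_trans (ltW wu)).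
pose Dw := om v - om u.
have DwE : Dw = - (Dx * (om v * om u / tau)).
  have -> : Dx = (x v - x s) - (x u - x s) by rewrite /Dx; ring.
  rewrite /Dw /om; field.
  by rewrite !subr_eq0 xus xvs gt_eqF.
have omE : om v * (x v - x s) = tau by rewrite divfK// subr_eq0.
clearbody om.
have Dwle : `|Dw| <= P * `|Dx|.
  rewrite DwE normrN normrM mulrC ler_wpM2r// !normrM normfV (gtr0_norm pi20).
  rewrite ler_pdivrMr// -[leLHS]mulr1 ler_pM ?mulr_ge0//.
  by rewrite /P expr2 ler_pM.
have Dw2 : `|Dw + Dx * (w ^+ 2 / tau)| <= 2 * eta * P * `|Dx|.
  rewrite DwE addrC -mulrBr -mulrBl normrM mulrC ler_wpM2r//.
  rewrite normrM normfV (gtr0_norm pi20) ler_pdivrMr// -[leLHS]mulr1 ler_pM//.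
  have -> : w ^+ 2 - om v * om u = (w - om v) * w + om v * (w - om u) by ring.
  apply: (le_trans (ler_normD _ _)); rewrite !normrM.
  have PE : `|w| + 1 <= P by rewrite /P expr2 ler_peMl ?(ltW w1)// lerDr.
  have i1 : `|w - om v| * `|w| <= eta * (`|w| + 1).
    by rewrite ler_pM// ?(ltW wv)// lerDl.
  have i2 : `|om v| * `|w - om u| <= eta * (`|w| + 1) by rewrite mulrC ler_pM// ltW.
  have i3 : eta * (`|w| + 1) <= eta * P by rewrite ler_wpM2l// (ltW eta0).
  have -> : 2 * eta * P = eta * P + eta * P by ring.
  by rewrite lerD// (le_trans _ i3).
(* The change of the integrand from frequency [om u] to [om v], less its linear part [- Dw * g z];
   what is left is o(Dw). *)
pose h z := cos (om v * (x z - x s)) - cos (om u * (x z - x s)) + Dw * g z.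
have ch : {within `[0, 1], continuous h}.
  by apply: within_continuousD; [exact: within_continuousB|exact: within_continuousZ].
have E1 : `|I s u h| <= `|Dw| * eta * B.
  have : `|I s u h| <= l1norm b * (`|Dw| * eta * (Rb * Rb)) * (W u - W s).
    apply: le_form_integral => //; [exact: ltW|exact: sub| |].
      by rewrite !mulr_ge0// ltW.
    move=> z /andP[sz zu]; have zR := xRb s z s0 (ltW sz) (le_trans (ltW zu) u1).
    have -> : h z = cos (om v * (x z - x s)) - cos (om u * (x z - x s)) +
        (om v * (x z - x s) - om u * (x z - x s)) * sin (w * (x z - x s)).
      by rewrite /h /g /Dw; ring.
    apply: (le_trans (@cos_increment _ _ _ _ (eta * Rb) _ _)).
    - by rewrite -mulrBl normrM ler_pM// ltW.
    - by rewrite -mulrBl normrM ler_pM// ltW.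
    rewrite -mulrBl normrM -/Dw -!mulrA ler_wpM2l//.
    by rewrite mulrCA ler_wpM2l ?(ltW eta0)// ler_wpM2r.
  move=> /le_trans; apply.
  have /andP[_ Wus] := W0 s u s0 (ltW su) u1.
  have -> : `|Dw| * eta * B = l1norm b * (`|Dw| * eta * (Rb * Rb)) * Wt.
    by rewrite /B; ring.
  by rewrite ler_wpM2l// !mulr_ge0// ltW.
have E4 : `|I u v (fun z => cos (om v * (x z - x s))) - 1 * Dy| <= l1norm b * eta * dW.
  apply: form_integral_subr_cst => //; [exact: sub|exact: ltW|].
  move=> z /andP[uz zv]; have z0 := le_trans u0 (ltW uz); have z1 := le_trans (ltW zv) v1.
  have Tz : `|T - z| < Num.min (T - s) (Num.min r2 r3).
    by apply: (dist_between_lt (ltW uz) (ltW zv)).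
  have [_ xz _] := near z z0 z1 Tz.
  rewrite -(@cos2pi R) -tauE; apply: (le_trans (cos_lipschitz _ _)).
  have -> : tau - om v * (x z - x s) = om v * ((H - (x z - x s)) - (H - (x v - x s))).
    by rewrite -omE; ring.
  rewrite normrM (@le_trans _ _ ((`|w| + 1) * (rho + rho)))//.
    rewrite ler_pM// (le_trans (ler_normB _ _))// lerD// ltW//.
  have -> : (`|w| + 1) * (rho + rho) = rho * (2 * (`|w| + 1)) by ring.
  by rewrite -ler_pdivlMr ?mulr_gt0.
(* The difference of the vanishing integrals over [[s, v]] and [[s, u]]. *)
have main : I s u h - Dw * I s u g + I u v (fun z => cos (om v * (x z - x s))) = 0.
  have -> : I s u h = I s u (fun z => cos (om v * (x z - x s))) -
      I s u (fun z => cos (om u * (x z - x s))) + Dw * I s u g.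
    rewrite /I form_integralD ?form_integralB ?form_integralZ// ?(ltW su)//;
      try exact: sub.
      by apply: sub => //; exact: within_continuousB.
    by apply: sub => //; exact: within_continuousZ.
  rewrite (cos0 u)// subr0 addrK -(cos0 v sv v1 xvs) /I.
  by rewrite (@form_integral_split _ _ _ _ _ _ s u v) ?(ltW su)//; exact: sub.
set J := I u v _ in E4 main.
(* Four errors: the derivative of the frequency, the moving end point in [kappa], the nonlinearity
   of the cosine, and its deviation from 1 on [[u, v]]. *)
have -> : Dy - - (w ^+ 2 / tau * kappa) * Dx =
    (Dw + Dx * (w ^+ 2 / tau)) * kappa - Dw * (kappa - I s u g) -
    I s u h - (J - 1 * Dy).
  have -> : I s u h = Dw * I s u g - J.
    by move/eqP: main; rewrite addr_eq0 subr_eq addrC => /eqP.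
  ring.
have F1 : `|(Dw + Dx * (w ^+ 2 / tau)) * kappa| <= 2 * eta * P * `|Dx| * `|kappa|.
  by rewrite normrM ler_wpM2r.
have F2 : `|Dw * (kappa - I s u g)| <= P * `|Dx| * eta.
  by rewrite normrM ler_pM// ltW.
have F3 : `|I s u h| <= P * `|Dx| * eta * B.
  by rewrite (le_trans E1)// ler_wpM2r// ler_wpM2r// ltW.
apply: (@le_trans _ _ (eta * C * dW)); last by rewrite ler_wpM2r.
apply: (le_trans (ler_normB _ _)); rewrite mul1r in E4 *.
apply: (le_trans (lerD (le_trans (ler_normB _ _) (lerD (le_trans (ler_normB _ _)
  (lerD F1 F2)) F3)) E4)).
have -> : 2 * eta * P * `|Dx| * `|kappa| + P * `|Dx| * eta + P * `|Dx| * eta * B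
    + l1norm b * eta * dW = eta * (P * (2 * `|kappa| + 1 + B)) * `|Dx| + eta * l1norm b * dW.
  by ring.
have -> : eta * C * dW = eta * (P * (2 * `|kappa| + 1 + B)) * (l1norm a * dW) +
    eta * l1norm b * dW by rewrite /C; ring.
by rewrite lerD2r ler_wpM2l// !mulr_ge0 ?(ltW eta0)// !addr_ge0// mulr_ge0.
Qed.

End first_order_relation.

(** * Collinearity *)

Section collinearity.
Context {R : realType} {d : nat}.
Variable gamma : R -> 'rV[R]_d.
Hypothesis cgamma : {within `[0, 1], continuous gamma}.
Hypothesis bgamma : path_bounded_variation 0 1 gamma.
Implicit Types (s t u v T : R).
Local Notation W := (pvar gamma).

Definition collinear_until T := exists (f : R -> R) (v : 'rV[R]_d),
  forall t, 0 <= t -> t <= T -> gamma t = gamma 0 + f t *: v.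

Lemma path_coord_inj u v :
  (forall i, path_coord gamma i u = path_coord gamma i v) -> gamma u = gamma v.
Proof. by move=> uv; apply/rowP => i; exact: uv. Qed.

Lemma collinear_until_extend T T' : 0 <= T -> T <= T' ->
  (forall t, T <= t -> t <= T' -> gamma t = gamma T) ->
  collinear_until T -> collinear_until T'.
Proof.
move=> T0 TT' cst [f [v fv]]; exists (fun t => if t <= T then f t else f T), v.
move=> t t0 tT'; have [tT|Tt] := leP t T; first exact: fv.
by rewrite cst// ?(ltW Tt)// fv.
Qed.

Lemma lform_delta i t :
  lform gamma (fun j => (j == i)%:R) t = path_coord gamma i t.
Proof.
rewrite /lform (bigD1 i)//= eqxx mul1r big1 ?addr0// => j /negPf ->.
by rewrite mul0r.
Qed.

Lemma lform_comb k i q t :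
  lform gamma (fun j => (j == k)%:R - q * (j == i)%:R) t =
  path_coord gamma k t - q * path_coord gamma i t.
Proof.
rewrite -!lform_delta /lform mulr_sumr -sumrB; apply: eq_bigr => j _.
by rewrite mulrBl mulrA.
Qed.

Lemma lform_combB k i q u v :
  lform gamma (fun j => (j == k)%:R - q * (j == i)%:R) v -
  lform gamma (fun j => (j == k)%:R - q * (j == i)%:R) u =
  (path_coord gamma k v - path_coord gamma k u) -
  q * (path_coord gamma i v - path_coord gamma i u).
Proof. by rewrite !lform_comb; ring. Qed.

(** With e = 1 / (d + 1) the bound passes to the total variation of each of the d coordinates;
    summing, dW is at most d / (d + 1) times itself, hence zero. *)
Lemma locally_constant_of_small_increments T :
  (forall e, 0 < e -> exists2 r, 0 < r & forall i u v,
    0 <= u -> u <= v -> v <= 1 -> `|T - u| < r -> `|T - v| < r ->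
    `|path_coord gamma i v - path_coord gamma i u| <= e * (W v - W u)) ->
  exists2 r, 0 < r & forall u v,
    0 <= u -> u <= v -> v <= 1 -> `|T - u| < r -> `|T - v| < r ->
    gamma v = gamma u.
Proof.
have d0 : 0 < d%:R + 1 :> R by rewrite ltr_wpDl.
move=> /(_ _ (divr_gt0 ltr01 d0))[r r0 small]; exists r => // u v u0 uv v1 Tu Tv.
have tv i : tvar (path_coord gamma i) v - tvar (path_coord gamma i) u <=
    1 / (d%:R + 1) * (W v - W u).
  have bi := path_coord_bounded_variation i bgamma.
  rewrite tvarB// -lee_fin fineK ?(total_variation_fin_num bi)// mulrBr.
  apply: (@dominated_total_variation _ _ (fun t => 1 / (d%:R + 1) * W t)) => //.
  move=> u' v' uu' uv' vv'; rewrite -mulrBr.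
  have u'v := le_trans uv' vv'; have uv'' := le_trans uu' uv'.
  apply: small => //; try exact: le_trans uu'; try exact: le_trans vv' _.
    exact: dist_between_lt Tu Tv.
  exact: dist_between_lt Tu Tv.
have W0 : W v - W u <= 0.
  have : W v - W u <= \sum_(i < d) 1 / (d%:R + 1) * (W v - W u).
    rewrite [leLHS](_ : _ = \sum_i (tvar (path_coord gamma i) v -
      tvar (path_coord gamma i) u)); last by rewrite sumrB.
    by apply: ler_sum => i _; exact: tv.
  rewrite sumr_const card_ord -[(_ * _) *+ d]mulr_natl mul1r mulrA => le.
  have : (W v - W u) * (d%:R + 1) <= d%:R * (W v - W u).
    by rewrite -ler_pdivlMr// mulrAC.
  by rewrite mulrDr mulr1 mulrC gerDl.
apply: path_coord_inj => i; apply/eqP; rewrite -subr_eq0 -normr_le0.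
apply: (le_trans (le_norm_tvar (path_coord_bounded_variation i bgamma) u0 uv v1)).
exact: le_trans (tvarB_le_pvarB bgamma i u0 uv v1) W0.
Qed.

Hypothesis entire_log_signature : forall s t : R, 0 <= s -> s <= t -> t <= 1 ->
  tradius (tlog (signature cgamma bgamma s t)) = +oo%E.

(* If [d gamma^k = q_k dx] at [T] for all [k] but some [y = gamma^k - q_k x] is
   not constant, then also [dx = q' dy = 0] to first order. *)
Lemma locally_constant_if_not_collinear T : 0 <= T -> T <= 1 ->
  ~ collinear_until T ->
  exists2 r, 0 < r & forall u v,
    0 <= u -> u <= v -> v <= 1 -> `|T - u| < r -> `|T - v| < r ->
    gamma v = gamma u.
Proof.
move=> T0 T1 nT.
(* Otherwise the path is constant on [[0, T]], hence collinear. *)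
have [i [s [s0 sT xsT]]] : exists i s, [/\ 0 <= s, s <= T &
    path_coord gamma i T != path_coord gamma i s].
  apply: contrapT => nx; apply: nT; exists (fun=> 0), 0 => t t0 tT.
  rewrite scaler0 addr0.
  have cT u : 0 <= u -> u <= T -> gamma u = gamma T.
    move=> u0 uT; apply: path_coord_inj => j; apply/eqP.
    apply: contrapT => /negP uT'; apply: nx; exists j, u; split => //.
    by rewrite eq_sym.
  by rewrite !cT.
pose x := path_coord gamma i.
have ex_q k : exists q, forall e, 0 < e -> exists2 r, 0 < r & forall u v,
    0 <= u -> u <= v -> v <= 1 -> `|T - u| < r -> `|T - v| < r ->
    `|(path_coord gamma k v - path_coord gamma k u) - q * (x v - x u)| <=
      e * (W v - W u).
  have [|q qP] := first_order_relation entire_log_signature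
    (a := fun j => (j == i)%:R) (fun j => (j == k)%:R) s0 sT T1.
    by rewrite !lform_delta.
  exists q => e e0; have [r r0 rP] := qP e e0; exists r => // u v u0 uv v1 Tu Tv.
  by have := rP u v u0 uv v1 Tu Tv; rewrite !lform_delta.
have [q qP] := choice ex_q.
(* Otherwise gamma_t - gamma_0 = (x_t - x_0) q on [[0, T]], which is collinear. *)
have [k [s' [s'0 s'T ysT]]] : exists k s', [/\ 0 <= s', s' <= T &
    path_coord gamma k T - q k * x T != path_coord gamma k s' - q k * x s'].
  apply: contrapT => ny; apply: nT.
  exists (fun t => x t - x 0), (\row_k q k) => t t0 tT.
  have yT k u : 0 <= u -> u <= T ->
      path_coord gamma k u - q k * x u = path_coord gamma k T - q k * x T.
    move=> u0 uT; apply/eqP; apply: contrapT => /negP uT'; apply: ny.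
    by exists k, u; split => //; rewrite eq_sym.
  apply/rowP => k; rewrite !mxE.
  have := yT k t t0 tT; rewrite -(yT k 0 (lexx _) T0) /path_coord.
  by move=> /eqP; rewrite subr_eq => /eqP ->; ring.
have [q' q'P] : exists q', forall e, 0 < e -> exists2 r, 0 < r & forall u v,
    0 <= u -> u <= v -> v <= 1 -> `|T - u| < r -> `|T - v| < r ->
    `|(x v - x u) - q' * ((path_coord gamma k v - path_coord gamma k u) -
       q k * (x v - x u))| <= e * (W v - W u).
  have [|p pP] := first_order_relation entire_log_signature
    (a := fun j => (j == k)%:R - q k * (j == i)%:R) (fun j => (j == i)%:R)
    s'0 s'T T1.
    by rewrite !lform_comb.
  exists p => e e0; have [r r0 rP] := pP e e0; exists r => // u v u0 uv v1 Tu Tv.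
  have := rP u v u0 uv v1 Tu Tv; rewrite !lform_delta.
  by rewrite lform_combB.
apply: locally_constant_of_small_increments => e e0.
pose Q := \sum_j `|q j|; have Q0 : 0 <= Q by exact: sumr_ge0.
(* From |dy| <= D follows |dx| <= (|q'| + 1) D; each coordinate then adds the factor |q_j| <= [Q]
   and an error [D] of its own. *)
pose C := Q * (`|q'| + 1) + 1; have C0 : 0 < C.
  by rewrite ltr_wpDl// mulr_ge0// addr_ge0.
have eC0 : 0 < e / C by rewrite divr_gt0.
have /choice[r rP] : forall j, exists r, 0 < r /\ forall u v,
    0 <= u -> u <= v -> v <= 1 -> `|T - u| < r -> `|T - v| < r ->
    `|(path_coord gamma j v - path_coord gamma j u) - q j * (x v - x u)| <=
      e / C * (W v - W u).
  by move=> j; have [r r0 rP] := qP j _ eC0; exists r.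
have [r' r'0 r'P] := q'P _ eC0.
near (0 : R)^'+ => rho.
have rr j : rho <= r j.
  by move: j; near: rho; apply: filter_forall => j; exact: nbhs_right_le (rP j).1.
exists rho; first by near: rho; exact: nbhs_right_gt.
have rr' : rho <= r' by near: rho; exact: nbhs_right_le.
move=> j u v u0 uv v1 Tu Tv; set D := e / C * (W v - W u).
have D0 : 0 <= D by rewrite mulr_ge0 ?(ltW eC0)// subr_ge0 (pvar_le bgamma).
have near_q l : `|(path_coord gamma l v - path_coord gamma l u) - q l * (x v - x u)| <= D.
  by apply: (rP l).2 => //; [exact: lt_le_trans Tu _|exact: lt_le_trans Tv _].
have Dx : `|x v - x u| <= (`|q'| + 1) * D.
  have : `|(x v - x u) - q' * ((path_coord gamma k v - path_coord gamma k u) -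
       q k * (x v - x u))| <= D.
    by apply: r'P => //; [exact: lt_le_trans Tu _|exact: lt_le_trans Tv _].
  set Dy := (X in q' * X) => h; rewrite -[x v - x u](subrK (q' * Dy)).
  rewrite (le_trans (ler_normD _ _))// mulrDl mul1r addrC lerD// normrM ler_wpM2l//.
  exact: near_q.
have -> : e * (W v - W u) = C * D by rewrite /D; field; rewrite gt_eqF.
rewrite -[X in `|X|](subrK (q j * (x v - x u))).
rewrite (le_trans (ler_normD _ _))// /C mulrDl mul1r addrC lerD// normrM -mulrA.
by rewrite ler_pM// /Q (bigD1 j)//= lerDl sumr_ge0.
Unshelve. all: by end_near. Qed.

Lemma constant_after T : 0 <= T -> T <= 1 ->
  (forall p, T <= p -> p <= 1 -> exists2 r, 0 < r & forall u v,
    0 <= u -> u <= v -> v <= 1 -> `|p - u| < r -> `|p - v| < r ->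
    gamma v = gamma u) ->
  gamma 1 = gamma T.
Proof.
move=> T0 T1 loc; apply: path_coord_inj => i.
apply: (@locally_constant_increments _ _ (fun=> 0)) => // e p e0 /andP[Tp p1].
have [r r0 rP] := loc p Tp p1; exists r => // u v Tu uv v1 pu pv.
by rewrite /path_coord (rP u v)// ?(le_trans T0)// !subrr normr0 mulr0.
Qed.

Lemma collinear_until_1 : collinear_until 1.
Proof.
apply: contrapT => n1.
pose N := [set T | 0 <= T <= 1 /\ ~ collinear_until T].
have N1 : N 1 by rewrite /N/= ler01 lexx.
have lbN : lbound N 0 by move=> T [/andP[]].
have infN : has_inf N by split; [exists 1|exists 0].
set T0 := inf N.
have T00 : 0 <= T0 by apply: lb_le_inf; [exists 1|].
have T01 : T0 <= 1 by exact: ge_inf infN.2 _ N1.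
have collinear_lt T : 0 <= T -> T < T0 -> collinear_until T.
  move=> T_ge0 TT0; apply: contrapT => nT.
  have : T0 <= T.
    by apply: ge_inf infN.2 _ _; split => //; rewrite T_ge0 (le_trans (ltW TT0)).
  by rewrite leNgt TT0.
have not_collinear_gt T : T0 < T -> T <= 1 -> ~ collinear_until T.
  move=> T0T T1 [f [v fv]]; have [T' [_ nT'] T'T] : exists2 T', N T' & T' < T.
    have /inf_adherent/(_ infN)[T' NT'] : 0 < T - T0 by rewrite subr_gt0.
    by rewrite addrC subrK => T'T; exists T'.
  by apply: nT'; exists f, v => t t0 tT'; apply: fv => //; rewrite (le_trans tT')// ltW.
have [cT0|nT0] := pselect (collinear_until T0).
(* No time after [T0] is collinear, so the path is locally constant on []T0, 1]], and by continuity
   constant on [[T0, 1]]; collinearity extends from [T0] to 1. *)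
- apply: (n1); have const T : T0 < T -> T <= 1 -> gamma 1 = gamma T.
    move=> T0T T1; apply: constant_after => //; first by rewrite (le_trans T00)// ltW.
    move=> p Tp p1; have T0p := lt_le_trans T0T Tp.
    apply: locally_constant_if_not_collinear => //.
      by rewrite (le_trans T00)// ltW.
    exact: not_collinear_gt.
  have T0_1 : T0 < 1.
    by rewrite lt_neqAle T01 andbT; apply/eqP => T0_1; apply: n1; rewrite -T0_1.
  have const0 : gamma T0 = gamma 1.
    apply: path_coord_inj => i; apply/eqP; rewrite -subr_eq0 -normr_le0.
    apply/ler_addgt0Pr => e e0; rewrite add0r.
    have T001 : 0 <= T0 <= 1 by rewrite T00.
    have /within_continuousP/(_ T0 e T001 e0)[r r0 rP] :=
      path_coord_continuous (i := i) cgamma.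
    pose u := Num.min 1 (T0 + r / 2).
    have T0u : T0 < u by rewrite lt_min T0_1 ltrDl divr_gt0.
    have u1 : u <= 1 by rewrite ge_min lexx.
    rewrite /path_coord (const u)// ltW//; apply: rP.
      by rewrite (le_trans T00 (ltW T0u)).
    rewrite distrC ger0_norm ?subr_ge0 ?(ltW T0u)// ltrBlDl.
    by rewrite gt_min ltrD2l ltr_pdivrMr// ltr_pMr// ltr1n orbT.
  apply: (collinear_until_extend T00 T01 _ cT0) => t.
  by rewrite le_eqVlt => /predU1P[<-//|T0t] t1; rewrite const0 (const t).
(* Collinearity until 0 is trivial, so there are times before [T0]. The path is constant just before
   [T0], and collinearity extends from such a time to [T0]. *)
- have T0_0 : 0 < T0.
    rewrite lt_neqAle T00 andbT; apply/eqP => T0_0; apply: nT0; rewrite -T0_0.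
    exists (fun=> 0), 0 => t t0 t0'; rewrite scaler0 addr0.
    by congr gamma; apply/eqP; rewrite eq_le t0'.
  have [r r0 rP] := locally_constant_if_not_collinear T00 T01 nT0.
  pose T := Num.max 0 (T0 - r / 2).
  have T_ge0 : 0 <= T by rewrite le_max lexx.
  have TT0 : T < T0 by rewrite gt_max T0_0 gtrBl divr_gt0.
  have Tr t : T <= t -> t <= T0 -> `|T0 - t| < r.
    move=> Tt tT0; rewrite ger0_norm ?subr_ge0// ltrBlDl -ltrBlDr.
    rewrite (lt_le_trans _ Tt)// lt_max ltrD2l ltrN2.
    by rewrite ltr_pdivrMr// ltr_pMr// ltr1n orbT.
  apply: nT0; apply: (collinear_until_extend T_ge0 (ltW TT0)); last exact: collinear_lt.
  move=> t Tt tT0; apply: rP => //; first exact: le_trans tT0 T01.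
    by apply: Tr => //; exact: ltW.
  exact: Tr.
Qed.

End collinearity.

Theorem theorem4p1 (R : realType) (d : nat) (gamma : R -> 'rV[R]_d)
    (cgamma : {within `[0, 1], continuous gamma})
    (bgamma : path_bounded_variation 0 1 gamma) :
  (forall s t : R, 0 <= s -> s <= t -> t <= 1 ->
     tradius (tlog (signature cgamma bgamma s t)) = +oo%E) ->
  exists (f : R -> R) (v : 'rV[R]_d),
    forall t : R, 0 <= t -> t <= 1 -> gamma t = gamma 0 + f t *: v.
Proof. exact: collinear_until_1. Qed.
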